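(* Let $V$ be an $\mathrm{FI}_G$-module over a commutative ring $k$ which is generated in finite degree. The following are equivalent: (1) $V$ is $\sharp$-filtered; (2) there is a sequence of surjections $V=Q^{(n)}\twoheadrightarrow Q^{(n-1)}\twoheadrightarrow\cdots\twoheadrightarrow Q^{(0)}=0$ whose successive kernels are relatively projective; (3) $V$ is homology acyclic; (4) $H_1(V)=0$; (5) $V$ admits a finite resolution $0\to P_s\to\cdots\to P_0\to V\to 0$ by homology acyclic $\mathrm{FI}_G$-modules $P_j$ which are generated in finite degree. If in addition $V$ is presented in finite degree, then each of these is also equivalent to: (6) $H_i(V)=0$ for some $i>0$.
   Context: Fix a commutative ring $k$ and a group $G$. $\mathrm{FI}_G$ is the category with objects $[n]=\{1,\dots,n\}$ ($n\ge 0$) and morphisms $[n]\to[m]$ the pairs $(f,g)$ with $f:[n]\to[m]$ injective and $g:[n]\to G$ a map of sets; composition is $(f,g)\circ(f',g')=(f\circ f',h)$ with $h(x)=g'(x)\,g(f'(x))$. Write $G_n=\mathfrak S_n\wr G=\mathrm{Aut}_{\mathrm{FI}_G}([n])$. An $\mathrm{FI}_G$-module is a functor $V:\mathrm{FI}_G\to\mathrm{Mod}_k$, $V_n:=V([n])$; these form an abelian category with pointwise kernels and cokernels. An $\mathrm{FB}_G$-module is a sequence $(W_n)_{n\ge0}$ with $W_n$ a $k[G_n]$-module. For a $k[G_n]$-module $W$, $M(W)$ is the $\mathrm{FI}_G$-module with $M(W)_m=W\otimes_{k[G_n]}k[\mathrm{Hom}_{\mathrm{FI}_G}([n],[m])]$,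 morphisms acting by postcomposition on the second factor; for an $\mathrm{FB}_G$-module $W$, $M(W)=\bigoplus_n M(W_n)$; $M(n):=M(k[G_n])$. Modules of the form $M(W)$ are called relatively projective. $V$ is $\sharp$-filtered if it has a finite filtration $0=V^{(0)}\subseteq\cdots\subseteq V^{(n)}=V$ with every $V^{(j)}/V^{(j-1)}$ relatively projective. $H_0(V)_n=V_n/V_{<n}$, where $V_{<n}$ is the span of images of all $V(f,g)$ with $(f,g):[m]\to[n]$, $m<n$; $H_i$ are the left derived functors of $H_0$. $V$ is homology acyclic if $H_i(V)=0$ for all $i\ge1$. $V$ is generated in degree $\le m$ if there is a surjection $\bigoplus_i M(n_i)\to V$ with all $n_i\le m$; generated in finite degree if this holds for some $m$. $V$ is related in degree $\le r$ if there is an exact sequence $0\to K\to M\to V\to 0$ with $M$ relatively projective and $K$ generated in degree $\le r$; $V$ is presented in finite degree if it is generated and related in finite degree. *)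

(* Defs.v *)
From mathcomp Require Import all_boot all_algebra.

Set Implicit Arguments.
Unset Strict Implicit.
Unset Printing Implicit Defensive.

Import GRing.Theory.
Local Open Scope ring_scope.

Section FIG.

Variables (k : comPzRingType) (G : groupType).

Record FIhom (n m : nat) := FIHom {
  fih_f : {ffun 'I_n -> 'I_m};
  fih_inj : injectiveb fih_f;
  fih_g : 'I_n -> G }.

Lemma FIcomp_inj n m p (h : FIhom m p) (h' : FIhom n m) :
  injectiveb [ffun x => fih_f h (fih_f h' x)].
Proof.
apply/injectiveP => x y; rewrite !ffunE => /(injectiveP _ (fih_inj h)).
by move/(injectiveP _ (fih_inj h')).
Qed.

Definition FIcomp n m p (h : FIhom m p) (h' : FIhom n m) : FIhom n p :=
  @FIHom n p [ffun x => fih_f h (fih_f h' x)] (FIcomp_inj h h')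
    (fun x => (fih_g h' x * fih_g h (fih_f h' x))%g).

Lemma FIid_inj n : injectiveb [ffun x : 'I_n => x].
Proof. by apply/injectiveP => x y; rewrite !ffunE. Qed.

Definition FIid n : FIhom n n := @FIHom n n [ffun x => x] (FIid_inj n) (fun _ => 1%g).

Definition klinear (A B : lmodType k) (f : A -> B) : Prop :=
  forall (a : k) (x y : A), f (a *: x + y) = a *: f x + f y.

Record FImod := FIMod {
  fobj : nat -> lmodType k;
  fmap : forall n m, FIhom n m -> fobj n -> fobj m;
  fmap_lin : forall n m (h : FIhom n m), klinear (fmap h);
  fmap_id : forall n (x : fobj n), fmap (FIid n) x = x;
  fmap_comp : forall n m p (h : FIhom m p) (h' : FIhom n m) (x : fobj n),
      fmap (FIcomp h h') x = fmap h (fmap h' x) }.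

Arguments fmap V [n m] h x : rename.

Record FImor (V W : FImod) := FIMor {
  mor : forall n, fobj V n -> fobj W n;
  mor_lin : forall n, klinear (@mor n);
  mor_nat : forall n m (h : FIhom n m) (x : fobj V n),
      mor (fmap V h x) = fmap W h (mor x) }.

Arguments mor [V W] f [n] x : rename.

Definition is_zero (V : FImod) : Prop := forall n (x : fobj V n), x = 0.

Definition mor_surj V W (p : FImor V W) : Prop :=
  forall n (y : fobj W n), exists x, mor p x = y.

Definition mor_inj V W (p : FImor V W) : Prop :=
  forall n, injective (@mor V W p n).

Definition exact_at A B C (f : FImor A B) (g : FImor B C) : Prop :=
  forall n (y : fobj B n), mor g y = 0 <-> exists x, mor f x = y.

Definition short_exact A B C (f : FImor A B) (g : FImor B C) : Prop :=
  [/\ mor_inj f, exact_at f g & mor_surj g].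

(* G_n = Aut_{FI_G}([n]) = Hom_{FI_G}([n],[n]) (every injection [n]->[n] is
   bijective); an FB_G-module is a sequence of k[G_n]-modules (left actions). *)
Record FBmod := FBMod {
  bobj : nat -> lmodType k;
  bact : forall n, FIhom n n -> bobj n -> bobj n;
  bact_lin : forall n (s : FIhom n n), klinear (bact s);
  bact_id : forall n (w : bobj n), bact (FIid n) w = w;
  bact_comp : forall n (s t : FIhom n n) (w : bobj n),
      bact (FIcomp s t) w = bact s (bact t w) }.

Arguments bact W [n] s w : rename.

(* V is (isomorphic to) M(W) = (+)_n W_n (x)_{k[G_n]} k[Hom_{FI_G}([n],-)],
   witnessed by the canonical maps Phi_{n,m} : W_n x Hom([n],[m]) -> V_m,
   w, h |-> w (x) h, which are k-linear in w, k[G_n]-balanced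
   (w (x) (h o s) = (s.w) (x) h), compatible with postcomposition, and such that
   V_m has the universal property of the direct sum over n of the tensor
   products W_n (x)_{k[G_n]} k[Hom([n],[m])]. *)
Definition is_M_of (W : FBmod) (V : FImod)
    (Phi : forall n m, bobj W n -> FIhom n m -> fobj V m) : Prop :=
  [/\ (forall n m (h : FIhom n m), klinear (fun w => Phi n m w h)),
      (forall n m (h : FIhom n m) (s : FIhom n n) (w : bobj W n),
          Phi n m w (FIcomp h s) = Phi n m (bact W s w) h),
      (forall n m p (h' : FIhom m p) (h : FIhom n m) (w : bobj W n),
          fmap V h' (Phi n m w h) = Phi n p w (FIcomp h' h)) &
      (forall m (Z : lmodType k) (psi : forall n, bobj W n -> FIhom n m -> Z),
          (forall n (h : FIhom n m), klinear (fun w => psi n w h)) ->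
          (forall n (h : FIhom n m) (s : FIhom n n) (w : bobj W n),
              psi n w (FIcomp h s) = psi n (bact W s w) h) ->
          exists f : fobj V m -> Z,
            [/\ klinear f,
                (forall n (w : bobj W n) (h : FIhom n m), f (Phi n m w h) = psi n w h) &
                (forall f' : fobj V m -> Z, klinear f' ->
                   (forall n (w : bobj W n) (h : FIhom n m), f' (Phi n m w h) = psi n w h) ->
                   forall x, f' x = f x)])].

Definition rel_projective (V : FImod) : Prop :=
  exists (W : FBmod) (Phi : forall n m, bobj W n -> FIhom n m -> fobj V m),
    is_M_of Phi.

(* P = (+)_{i in I} M(deg i) with canonical generators e_i in P_{deg i}
   (M(n) = M(k[G_n]) = k[Hom_{FI_G}([n],-)] represents U |-> U_n), expressed
   by the universal property of this direct sum of representables. *)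
Definition free_on (P : FImod) (I : Type) (deg : I -> nat)
    (e : forall i, fobj P (deg i)) : Prop :=
  forall (U : FImod) (u : forall i, fobj U (deg i)),
    exists f : FImor P U,
      (forall i, mor f (e i) = u i) /\
      (forall f' : FImor P U, (forall i, mor f' (e i) = u i) ->
         forall n (x : fobj P n), mor f' x = mor f x).

Definition gen_in_deg (V : FImod) (m : nat) : Prop :=
  exists (P : FImod) (I : Type) (deg : I -> nat) (e : forall i, fobj P (deg i)),
    [/\ free_on e, (forall i, (deg i <= m)%N) & exists p : FImor P V, mor_surj p].

Definition gen_finite (V : FImod) : Prop := exists m, gen_in_deg V m.

Definition rel_in_deg (V : FImod) (r : nat) : Prop :=
  exists (K M : FImod) (i : FImor K M) (p : FImor M V),
    [/\ short_exact i p, rel_projective M & gen_in_deg K r].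

Definition presented_finite (V : FImod) : Prop :=
  gen_finite V /\ exists r, rel_in_deg V r.

Inductive lowdeg (V : FImod) (n : nat) : fobj V n -> Prop :=
  | lowdeg0 : lowdeg 0
  | lowdeg_im m (lt_mn : (m < n)%N) (h : FIhom m n) (y : fobj V m) :
      lowdeg (fmap V h y)
  | lowdegD x y : lowdeg x -> lowdeg y -> lowdeg (x + y)
  | lowdegZ (a : k) x : lowdeg x -> lowdeg (a *: x).

Definition projective (P : FImod) : Prop :=
  forall (U U' : FImod) (p : FImor U U') (a : FImor P U'),
    mor_surj p -> exists b : FImor P U, forall n (x : fobj P n), mor p (mor b x) = mor a x.

Definition proj_resolution (V : FImod) (P : nat -> FImod)
    (d : forall j, FImor (P j.+1) (P j)) (eps : FImor (P 0) V) : Prop :=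
  [/\ forall j, projective (P j), mor_surj eps, exact_at (d 0) eps &
      forall j, exact_at (d j.+1) (d j)].

(* H_i(V) = 0, where H_i is the i-th left derived functor of H_0: computed as
   the i-th homology of H_0 applied to a projective resolution of V (independent
   of the resolution; we quantify over all of them).  Since
   H_0(P)_n = P_n / P_{<n}, vanishing of the homology of H_0(P_.) at position i
   and degree n unfolds to the condition below. *)
Definition H_vanishes (V : FImod) (i : nat) : Prop :=
  forall (P : nat -> FImod) (d : forall j, FImor (P j.+1) (P j)) (eps : FImor (P 0) V),
    proj_resolution d eps ->
    forall n,
      match i return (fobj (P i) n -> Prop) -> Prop with
      | 0 => fun Q => forall x, Q x
      | j.+1 => fun Q => forall x : fobj (P j.+1) n, lowdeg (mor (d j) x) -> Q x
      end
      (fun x => exists (y : fobj (P i.+1) n) (z : fobj (P i) n),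
                  lowdeg z /\ x = mor (d i) y + z).

Definition homology_acyclic (V : FImod) : Prop :=
  forall i, (0 < i)%N -> H_vanishes V i.

Definition sharp_filtered (V : FImod) : Prop :=
  exists (n : nat) (F : nat -> FImod) (R : nat -> FImod)
         (incl : forall j, FImor (F j) (F j.+1)) (q : forall j, FImor (F j.+1) (R j)),
    [/\ is_zero (F 0), F n = V &
        forall j, (j < n)%N -> rel_projective (R j) /\ short_exact (incl j) (q j)].

Definition surj_filtered (V : FImod) : Prop :=
  exists (n : nat) (Q : nat -> FImod) (K : nat -> FImod)
         (q : forall j, FImor (Q j.+1) (Q j)) (i : forall j, FImor (K j) (Q j.+1)),
    [/\ Q n = V, is_zero (Q 0) &
        forall j, (j < n)%N -> rel_projective (K j) /\ short_exact (i j) (q j)].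

Definition acyclic_fin_resolution (V : FImod) : Prop :=
  exists (s : nat) (P : nat -> FImod) (d : forall j, FImor (P j.+1) (P j))
         (eps : FImor (P 0) V),
    [/\ forall j, (j <= s)%N -> homology_acyclic (P j) /\ gen_finite (P j),
        mor_surj eps,
        (s = 0%N -> mor_inj eps),
        ((0 < s)%N -> exact_at (d 0%N) eps /\ mor_inj (d s.-1)) &
        forall j, (j.+1 < s)%N -> exact_at (d j.+1) (d j)].

End FIG.

(* Main.v *)
(** Write [D V] for the cokernel of the natural map [iota : V -> Sh V] into the
    shift of [V], and call [V] torsion-free ([tf]) when [iota] is injective.
    For torsion-free [V] one has H_i(D V)_n = H_i(V)_(n+1), so if all the
    iterated derivatives [D^b V] are torsion-free (property [T]) then [V] is
    homology acyclic.  Property [T] holds for M(W), because D M(W) is again of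
    this form, and it passes to extensions, to kernels of surjections and, which
    is what makes (5) work, to cokernels of injections: an element killed by
    [iota] in a cokernel B/A gives an element killed by [iota] in [D A].
    Conversely, if H_1(V) = 0 and [V] is generated in finite degree, the
    filtration of [V] by degree of generation has relatively projective quotients.

    For (6), a submodule [K] of [P], both generated in finite degree and [P] with
    property [T], is presented in finite degree, by induction on the generation
    degree of [P]: the image [I] of [D K -> D P] is covered by induction, the kernel
    of [D K -> I] lives in finitely many degrees because [iota] kills it, and
    presentations pass from [D K] to the torsion-free [K].  Hence all syzygies of
    a module presented in finite degree are generated in finite degree, and
    H_i(V) = 0 makes the (i-1)-st one, and then [V], satisfy [T]. *)

From HB Require Import structures.
From mathcomp Require Import all_boot all_algebra.
From mathcomp Require Import boolp.
Require Import Defs.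

Set Implicit Arguments.
Unset Strict Implicit.
Unset Printing Implicit Defensive.

Import GRing.Theory.

(** * Morphisms of FI_G: adding a last point, and factoring maps through [iota] or [ext] *)

Section FIhomTheory.
Variable G : groupType.
Notation Hom := (FIhom G).
Notation "h \c h'" := (FIcomp h h') (at level 40, left associativity).

Lemma FIhom_eq n m (h h' : Hom n m) :
  fih_f h =1 fih_f h' -> fih_g h =1 fih_g h' -> h = h'.
Proof.
case: h h' => [f fi g] [f' fi' g'] /= /ffunP ef /funext eg.
by case: f' / ef fi' => fi'; rewrite eg (bool_irrelevance fi fi').
Qed.

Definition mkFI n m (f : 'I_n -> 'I_m) (fI : injective f) (g : 'I_n -> G) : Hom n m.
Proof.
apply: (@FIHom G n m [ffun x => f x] _ g).
by apply/injectiveP => x y; rewrite !ffunE => /fI.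
Defined.

Lemma mkFI_f n m (f : 'I_n -> 'I_m) (fI : injective f) g x : fih_f (mkFI fI g) x = f x.
Proof. by rewrite ffunE. Qed.

Lemma FIcomp_f n m p (h : Hom m p) (h' : Hom n m) x :
  fih_f (h \c h') x = fih_f h (fih_f h' x).
Proof. by rewrite ffunE. Qed.

Lemma FIid_f n x : fih_f (FIid G n) x = x.
Proof. by rewrite ffunE. Qed.

Lemma fihI n m (h : Hom n m) : injective (fih_f h).
Proof. exact/injectiveP/fih_inj. Qed.

Lemma FIcompA n m p q (h : Hom p q) (h' : Hom m p) (h'' : Hom n m) :
  h \c (h' \c h'') = (h \c h') \c h''.
Proof. by apply: FIhom_eq => x; rewrite ?FIcomp_f //= ?ffunE /= ?ffunE mulgA. Qed.

Lemma FIcomp1h n m (h : Hom n m) : FIid G m \c h = h.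
Proof. by apply: FIhom_eq => x; rewrite ?FIcomp_f /= ?ffunE ?mulg1. Qed.

Lemma FIcomph1 n m (h : Hom n m) : h \c FIid G n = h.
Proof. by apply: FIhom_eq => x; rewrite ?FIcomp_f /= ?ffunE ?mul1g. Qed.

Lemma FIhom_leq n m : Hom n m -> n <= m.
Proof. by move=> h; rewrite -(card_ord n) -(card_ord m); apply: leq_card (@fihI _ _ h). Qed.

Lemma FIinv n (s : Hom n n) : exists t, t \c s = FIid G n /\ s \c t = FIid G n.
Proof.
have sI := @fihI _ _ s.
have tI := can_inj (f_invF sI).
exists (mkFI tI (fun x => (fih_g s (invF sI x))^-1%g)).
split; apply: FIhom_eq => x; rewrite ?FIcomp_f /= ?ffunE ?invF_f ?f_invF //.
  by rewrite mulgV.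
by rewrite mulVg.
Qed.

Definition iota n : Hom n n.+1 := mkFI (@lift_inj n.+1 ord_max) (fun _ => 1%g).

Definition ext_fun n m (f : 'I_n -> 'I_m) (x : 'I_n.+1) : 'I_m.+1 :=
  if unlift ord_max x is Some y then lift ord_max (f y) else ord_max.

Lemma ext_fun_inj n m (f : 'I_n -> 'I_m) : injective f -> injective (ext_fun f).
Proof.
move=> fI x y; rewrite /ext_fun.
case: unliftP => [x' ->|->]; case: unliftP => [y' ->|->] //.
- by move=> /lift_inj/fI ->.
- by move=> e; have := neq_lift ord_max (f x'); rewrite e eqxx.
- by move=> e; have := neq_lift ord_max (f y'); rewrite -e eqxx.
Qed.

(** This is the disjoint union of [h] with the identity of one new point, placed last. It is
    functorial and, by [ext_iota], compatible with [iota]; shifting a module is precomposition with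
    it. *)
Definition ext n m (h : Hom n m) : Hom n.+1 m.+1 :=
  mkFI (ext_fun_inj (@fihI _ _ h))
    (fun x => if unlift ord_max x is Some y then fih_g h y else 1%g).

Lemma ext_lift n m (h : Hom n m) x : fih_f (ext h) (lift ord_max x) = lift ord_max (fih_f h x).
Proof. by rewrite mkFI_f /ext_fun liftK. Qed.

Lemma ext_max n m (h : Hom n m) : fih_f (ext h) ord_max = ord_max.
Proof. by rewrite mkFI_f /ext_fun unlift_none. Qed.

Lemma extg_lift n m (h : Hom n m) x : fih_g (ext h) (lift ord_max x) = fih_g h x.
Proof. by rewrite /= liftK. Qed.

Lemma extg_max n m (h : Hom n m) : fih_g (ext h) ord_max = 1%g.
Proof. by rewrite /= unlift_none. Qed.

Lemma ord_max_ind n (P : 'I_n.+1 -> Prop) :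
  P ord_max -> (forall y, P (lift ord_max y)) -> forall x, P x.
Proof. by move=> H1 H2 x; case: (unliftP ord_max x) => [y ->|->]. Qed.

Lemma ext_id n : ext (FIid G n) = FIid G n.+1.
Proof.
apply: FIhom_eq; elim/ord_max_ind => [|y];
  by rewrite ?ext_max ?ext_lift ?extg_max ?extg_lift /= ?ffunE.
Qed.

Lemma ext_comp n m p (h : Hom m p) (h' : Hom n m) : ext (h \c h') = ext h \c ext h'.
Proof.
apply: FIhom_eq; elim/ord_max_ind => [|y];
  rewrite ?FIcomp_f ?ext_max ?ext_lift ?FIcomp_f //.
  by rewrite -[RHS]/(_ * _)%g ext_max !extg_max mulg1.
by rewrite -[RHS]/(_ * _)%g ext_lift !extg_lift.
Qed.

Lemma ext_iota n m (h : Hom n m) : ext h \c iota n = iota m \c h.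
Proof.
apply: FIhom_eq => x; rewrite ?FIcomp_f.
  by rewrite !mkFI_f /ext_fun liftK.
by rewrite -[LHS]/(_ * _)%g -[RHS]/(_ * _)%g mkFI_f extg_lift mulg1 mul1g.
Qed.

Lemma iota_inj n m (h h' : Hom n m) : iota m \c h = iota m \c h' -> h = h'.
Proof.
move=> E; apply: FIhom_eq => x.
  have := congr1 (fun u => fih_f u x) E; rewrite !FIcomp_f !mkFI_f.
  exact: lift_inj.
have := congr1 (fun u => fih_g u x) E; rewrite /= !mulg1; exact.
Qed.

Lemma ext_restr n m (u : Hom n.+1 m.+1) :
  fih_f u ord_max = ord_max -> fih_g u ord_max = 1%g -> exists h, u = ext h.
Proof.
move=> uf ug.
have ul x : exists y, fih_f u (lift ord_max x) = lift ord_max y.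
  case: (unliftP ord_max (fih_f u (lift ord_max x))) => [y ->|]; first by exists y.
  by rewrite -[in RHS]uf => /fihI e; have := neq_lift ord_max x; rewrite e eqxx.
have [f fE] := choice ul.
have fI : injective f.
  by move=> x y e; apply: (@lift_inj _ ord_max); apply: (@fihI _ _ u); rewrite !fE e.
exists (mkFI fI (fun x => fih_g u (lift ord_max x))).
apply: FIhom_eq; elim/ord_max_ind => [|y].
- by rewrite ext_max.
- by rewrite ext_lift mkFI_f.
- by rewrite extg_max.
- by rewrite extg_lift.
Qed.

Lemma ext_inj n m (h h' : Hom n m) : ext h = ext h' -> h = h'.
Proof.
move=> E; apply: FIhom_eq => x.
  by have := congr1 (fun u => fih_f u (lift ord_max x)) E; rewrite !ext_lift => /lift_inj.
by have := congr1 (fun u => fih_g u (lift ord_max x)) E; rewrite !extg_lift.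
Qed.

Lemma FIhom_case n m (h : Hom n m.+1) :
  (exists h', h = iota m \c h') \/
  (exists x, fih_f h x = ord_max).
Proof.
case: (pselect (exists x, fih_f h x = ord_max)) => [|nx]; [by right | left].
have hl x : exists y, fih_f h x = lift ord_max y.
  case: (unliftP ord_max (fih_f h x)) => [y ->|e]; first by exists y.
  by case: nx; exists x.
have [f fE] := choice hl.
have fI : injective f by move=> x y e; apply: (@fihI _ _ h); rewrite !fE e.
exists (mkFI fI (fih_g h)); apply: FIhom_eq => x; first by rewrite FIcomp_f !mkFI_f.
by rewrite /= mulg1.
Qed.

(** An automorphism [t] of the source brings [x] into last position and carries the inverse of the
    label of [h] at [x]. Then [h] after [t] fixes the last point with trivial label, so it is an
    [ext]. *)
Lemma FIhom_hit n m (h : Hom n.+1 m.+1) x : fih_f h x = ord_max ->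
  exists h' (s : Hom n.+1 n.+1), h = ext h' \c s.
Proof.
move=> hx.
pose tf (y : 'I_n.+1) := if unlift ord_max y is Some z then lift x z else x.
pose tg (y : 'I_n.+1) := if unlift ord_max y is Some z then 1%g else (fih_g h x)^-1%g.
have tI : injective tf.
  move=> y y'; rewrite /tf; case: unliftP => [z ->|->]; case: unliftP => [z' ->|->] //.
  - by move=> /lift_inj ->.
  - by move=> e; have := neq_lift x z; rewrite e eqxx.
  - by move=> e; have := neq_lift x z'; rewrite -e eqxx.
pose t := mkFI tI tg.
have tm : fih_f t ord_max = x by rewrite mkFI_f /tf unlift_none.
have [|h' E] := @ext_restr _ _ (h \c t) (etrans (FIcomp_f _ _ _) (etrans (congr1 _ tm) hx)).
  by rewrite -[LHS]/(_ * _)%g tm /= /tg unlift_none mulVg.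
have [s [_ ts]] := FIinv t.
by exists h', s; rewrite -E -FIcompA ts FIcomph1.
Qed.

Lemma iota_neq_ext n m (h : Hom n.+1 m) (h' : Hom n m) (s : Hom n.+1 n.+1) :
  iota m \c h <> ext h' \c s.
Proof.
have [t [_ st]] := FIinv s.
move=> /(congr1 (fun u => fih_f u (fih_f t ord_max))).
rewrite !FIcomp_f -[fih_f s _]FIcomp_f st FIid_f ext_max mkFI_f => e.
by have := neq_lift ord_max (fih_f h (fih_f t ord_max)); rewrite e eqxx.
Qed.

(** The composite of [s2] with the inverse of [s1] fixes the last point with trivial label, hence is
    some [ext r]. So the decomposition in [FIhom_hit] is unique up to G_n, which makes functions
    defined through it well defined. *)
Lemma ext_decomp_uniq n m (h1 h2 : Hom n m) (s1 s2 : Hom n.+1 n.+1) :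
  ext h1 \c s1 = ext h2 \c s2 -> exists r, s2 = ext r \c s1 /\ h1 = h2 \c r.
Proof.
have [t [ts st]] := FIinv s1 => E.
have E1 : ext h1 = ext h2 \c (s2 \c t) by rewrite FIcompA -E -FIcompA st FIcomph1.
have um : fih_f (s2 \c t) ord_max = ord_max.
  by apply: (@fihI _ _ (ext h2)); rewrite -FIcomp_f -E1 !ext_max.
have [|r rE] := ext_restr um.
  have := congr1 (fun u => fih_g u ord_max) E1.
  by rewrite extg_max -[RHS]/(_ * _)%g um extg_max mulg1 => <-.
exists r; split; first by rewrite -rE -FIcompA ts FIcomph1.
by apply: ext_inj; rewrite ext_comp -rE.
Qed.

(** By counting, [h] misses some point [y], and the added point is sent there. *)
Lemma FIhom_extend n m (h : Hom n m) : n < m -> exists h', h = h' \c iota n.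
Proof.
move=> lt_nm.
have [y yP] : exists y, forall x, fih_f h x != y.
  apply: contrapT => nex; have : m <= n; last by rewrite leqNgt lt_nm.
  have /choice[r rK] : forall y, exists x, fih_f h x = y.
    move=> y; apply: contrapT => ny; apply: nex; exists y => x.
    by apply/eqP => e; apply: ny; exists x.
  rewrite -(card_ord n) -(card_ord m); apply: (leq_card r) => a b e.
  by rewrite -(rK a) e rK.
pose f (x : 'I_n.+1) := if unlift ord_max x is Some z then fih_f h z else y.
have fI : injective f.
  move=> a b; rewrite /f; case: unliftP => [z ->|->]; case: unliftP => [z' ->|->] //.
  - by move=> /fihI ->.
  - by move=> e; have := yP z; rewrite e eqxx.
  - by move=> e; have := yP z'; rewrite -e eqxx.
exists (mkFI fI (fun x => if unlift ord_max x is Some z then fih_g h z else 1%g)).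
apply: FIhom_eq => x; first by rewrite FIcomp_f !mkFI_f /f liftK.
by rewrite -[RHS]/(_ * _)%g mkFI_f /= liftK mul1g.
Qed.

Lemma FIhom_factor n m (h : Hom n m.+1) : n <= m ->
  exists (h1 : Hom m m.+1) (h2 : Hom n m), h = h1 \c h2.
Proof.
move=> le_nm; move dE: (m - n)%N => d; elim: d n h le_nm dE => [|d IH] n h le_nm dE.
  have e : n = m by apply/eqP; rewrite eqn_leq le_nm -subn_eq0 dE.
  by case: m / e h {le_nm dE} => h; exists h, (FIid G n); rewrite FIcomph1.
have lt_nm : n < m by rewrite -subn_gt0 dE.
have [h' ->] := FIhom_extend h (ltn_trans lt_nm (ltnSn m)).
have [||h1 [h2 ->]] := IH n.+1 h' => //; first by rewrite subnS dE.
by exists h1, (h2 \c iota n); rewrite FIcompA.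
Qed.

End FIhomTheory.

Local Open Scope ring_scope.

(** * Modules as quotients of setoids *)

Lemma sval_inj (T : Type) (P : T -> Prop) : injective (@sval T P).
Proof.
by move=> [x px] [y py] /= exy; case: y / exy py => py; rewrite (Prop_irrelevance px py).
Qed.

Section SetoidModule.
Variables (k : comPzRingType) (X : Type) (e : X -> X -> Prop).
Variables (z : X) (add : X -> X -> X) (sc : k -> X -> X).
Hypotheses (e_refl : forall x, e x x) (e_sym : forall x y, e x y -> e y x)
  (e_trans : forall x y t, e x y -> e y t -> e x t).
Hypotheses (e_add : forall x x' y y', e x x' -> e y y' -> e (add x y) (add x' y'))
  (e_sc : forall a x x', e x x' -> e (sc a x) (sc a x')).
Hypotheses (e_addA : forall x y t, e (add x (add y t)) (add (add x y) t))
  (e_addC : forall x y, e (add x y) (add y x))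
  (e_add0 : forall x, e (add z x) x)
  (e_addN : forall x, e (add (sc (-1) x) x) z)
  (e_scA : forall a b x, e (sc a (sc b x)) (sc (a * b) x))
  (e_sc1 : forall x, e (sc 1 x) x)
  (e_scDr : forall a x y, e (sc a (add x y)) (add (sc a x) (sc a y)))
  (e_scDl : forall x a b, e (sc (a + b) x) (add (sc a x) (sc b x))).

(** Classes are predicates, so related elements give equal classes by functional and propositional
    extensionality; representatives are then picked by choice. *)
Definition setoid_class := {A : X -> Prop | exists x, A = e x}.

Let pi x : setoid_class := exist _ (e x) (ex_intro _ x erefl).
Let rep (q : setoid_class) : X := sval (cid (svalP q)).

Let piP x y : e x y -> pi x = pi y.
Proof.
move=> exy; apply: sval_inj; apply/funext => t; apply/propext.
by split; [apply: e_trans; apply: e_sym | apply: e_trans].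
Qed.

Let piI x y : pi x = pi y -> e x y.
Proof. by move=> /(congr1 sval) /= ->. Qed.

Let repK q : pi (rep q) = q.
Proof. by apply: sval_inj; rewrite /rep; case: cid => x /= <-. Qed.

Let rep_pi x : e (rep (pi x)) x.
Proof. by apply: piI; rewrite repK. Qed.

Let piW (P : setoid_class -> Prop) : (forall x, P (pi x)) -> forall q, P q.
Proof. by move=> H q; rewrite -[q]repK. Qed.

Let qadd p q := pi (add (rep p) (rep q)).
Let qsc a p := pi (sc a (rep p)).

Let qaddE x y : qadd (pi x) (pi y) = pi (add x y).
Proof. by apply: piP; apply: e_add; apply: rep_pi. Qed.
Let qscE a x : qsc a (pi x) = pi (sc a x).
Proof. by apply: piP; apply: e_sc; apply: rep_pi. Qed.

(** The opposite of an element is its multiple by -1, so negation is not a separate operation. *)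
Lemma setoid_lmodType : exists (Q : lmodType k) (p : X -> Q),
  [/\ forall q, exists x, p x = q, forall x y, p x = p y <-> e x y,
      forall x y, p (add x y) = p x + p y & forall a x, p (sc a x) = a *: p x].
Proof.
have qaddA : associative qadd.
  by elim/piW=> x; elim/piW=> y; elim/piW=> t; rewrite !qaddE; apply: piP.
have qaddC : commutative qadd.
  by elim/piW=> x; elim/piW=> y; rewrite !qaddE; apply: piP.
have qadd0 : left_id (pi z) qadd by elim/piW=> x; rewrite qaddE; apply: piP.
have qaddN : left_inverse (pi z) (qsc (-1)) qadd.
  by elim/piW=> x; rewrite qscE qaddE; apply: piP.
pose E := gen_eqMixin setoid_class.
pose C := gen_choiceMixin setoid_class.
pose Ct : choiceType := HB.pack setoid_class E C.
pose Zm := GRing.isZmodule.Build Ct qaddA qaddC qadd0 qaddN.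
pose Zt : zmodType := HB.pack Ct Zm.
have scA a b (q : Zt) : qsc a (qsc b q) = qsc (a * b) q.
  by elim/piW: q => x; rewrite !qscE; apply: piP.
have sc1 : left_id 1 (qsc : k -> Zt -> Zt).
  by elim/piW=> x; rewrite qscE; apply: piP.
have scDr : right_distributive (qsc : k -> Zt -> Zt) +%R.
  move=> a; elim/piW=> x; elim/piW=> y.
  change (qsc a (qadd (pi x) (pi y)) = qadd (qsc a (pi x)) (qsc a (pi y))).
  by rewrite qaddE !qscE qaddE; apply: piP.
have scDl (q : Zt) : {morph (fun a => qsc a q : Zt) : a b / a + b}.
  elim/piW: q => x a b.
  change (qsc (a + b) (pi x) = qadd (qsc a (pi x)) (qsc b (pi x))).
  by rewrite !qscE qaddE; apply: piP.
pose L := GRing.Zmodule_isLmodule.Build k Zt scA sc1 scDr scDl.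
pose Q : lmodType k := HB.pack Zt L.
exists Q, pi; split=> [q|x y|x y|a x].
- by exists (rep q); apply: repK.
- by split; [apply: piI | apply: piP].
- by exact: esym (qaddE x y).
- by exact: esym (qscE a x).
Qed.
End SetoidModule.

(** * Linear maps, submodules, quotients and free modules over [k] *)

Section Linear.
Variable k : comPzRingType.
Implicit Types A B C V Z : lmodType k.

Lemma klin0 A B (f : A -> B) : klinear f -> f 0 = 0.
Proof. by move=> fl; have := fl 1 0 0; rewrite !scale1r addr0 -{1}[f 0]addr0 => /addrI. Qed.

Lemma klinD A B (f : A -> B) : klinear f -> {morph f : x y / x + y}.
Proof. by move=> fl x y; have := fl 1 x y; rewrite !scale1r. Qed.

Lemma klinZ A B (f : A -> B) : klinear f -> forall a, {morph f : x / a *: x}.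
Proof. by move=> fl a x; have := fl a x 0; rewrite (klin0 fl) !addr0. Qed.

Lemma klinB A B (f : A -> B) : klinear f -> {morph f : x y / x - y}.
Proof. by move=> fl x y; rewrite (klinD fl) -scaleN1r (klinZ fl) scaleN1r. Qed.

Lemma klin_comp A B C (f : A -> B) (g : B -> C) :
  klinear f -> klinear g -> klinear (fun x => g (f x)).
Proof. by move=> fl gl a x y; rewrite fl gl. Qed.

Lemma klin_const0 A B : klinear (fun _ : A => 0 : B).
Proof. by move=> a x y; rewrite scaler0 addr0. Qed.

Lemma klin_inj A B (f : A -> B) :
  klinear f -> (forall x, f x = 0 -> x = 0) -> injective f.
Proof.
by move=> fl f0 x y exy; apply/subr0_eq/f0; rewrite (klinB fl) exy subrr.
Qed.

Lemma factor_epi_lin A B C (q : A -> B) (u : A -> C) :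
  klinear q -> (forall y, exists x, q x = y) -> klinear u ->
  (forall x, q x = 0 -> u x = 0) ->
  exists2 v : B -> C, klinear v & forall x, v (q x) = u x.
Proof.
move=> ql /choice[r rK] ul qu.
have E x : u (r (q x)) = u x.
  by apply/subr0_eq; rewrite -(klinB ul); apply: qu; rewrite (klinB ql) rK subrr.
exists (fun y => u (r y)) => // a x y.
by rewrite -ul -[in RHS]E ql !rK.
Qed.

Lemma factor_mono_lin A B C (f : A -> B) (u : C -> B) :
  klinear f -> injective f -> klinear u -> (forall x, exists a, f a = u x) ->
  exists2 v : C -> A, klinear v & forall x, f (v x) = u x.
Proof.
move=> fl fI ul /choice[v vE]; exists v => // a x y.
by apply: fI; rewrite fl !vE ul.
Qed.

Definition submod V (S : V -> Prop) :=
  S 0 /\ forall a x y, S x -> S y -> S (a *: x + y).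

Section Submod.
Variables (V : lmodType k) (S : V -> Prop).
Hypothesis subS : submod S.

Lemma submodD x y : S x -> S y -> S (x + y).
Proof. by move=> Sx Sy; rewrite -[x]scale1r; apply: subS.2. Qed.
Lemma submodZ a x : S x -> S (a *: x).
Proof. by move=> Sx; rewrite -[_ *: _]addr0; apply: subS.2 => //; case: subS. Qed.
Lemma submodB x y : S x -> S y -> S (x - y).
Proof. by move=> Sx Sy; apply: submodD => //; rewrite -scaleN1r; apply: submodZ. Qed.

(** The carrier is the subtype modulo equality of underlying elements, so that [setoid_lmodType]
    supplies the module structure. *)
Lemma sub_lmod : exists (K : lmodType k) (i : K -> V),
  [/\ klinear i, injective i & forall x, S x <-> exists y, i y = x].
Proof.
pose X := {x | S x}.
pose add (x y : X) : X := exist _ _ (submodD (svalP x) (svalP y)).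
pose sc a (x : X) : X := exist _ _ (submodZ a (svalP x)).
have [|||||||||||||K [p [psurj pE pD pZ]]] := @setoid_lmodType k X
    (fun x y => sval x = sval y) (exist _ 0 subS.1) add sc => //=.
- by move=> x y t -> ->.
- by move=> x x' y y' -> ->.
- by move=> a x x' ->.
- by move=> x y t; rewrite addrA.
- by move=> x y; rewrite addrC.
- by move=> x; rewrite add0r.
- by move=> x; rewrite scaleN1r addNr.
- by move=> a b x; rewrite scalerA.
- by move=> x; rewrite scale1r.
- by move=> a x y; rewrite scalerDr.
- by move=> x a b; rewrite scalerDl.
have [r rK] := choice psurj.
have E x : sval (r (p x)) = sval x by apply/pE; rewrite rK.
exists K, (fun q => sval (r q)); split=> [a|q q' /pE|x].
- move=> x y; rewrite -[in LHS](rK x) -[in LHS](rK y) -pZ -pD E.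
  by [].
- by rewrite !rK.
split=> [Sx|[y <-]]; last exact: svalP.
by exists (p (exist _ x Sx)); rewrite E.
Qed.

Lemma quot_lmod : exists (Q : lmodType k) (q : V -> Q),
  [/\ klinear q, forall y, exists x, q x = y & forall x, q x = 0 <-> S x].
Proof.
have [|||||||||||||Q [p [psurj pE pD pZ]]] := @setoid_lmodType k V
    (fun x y => S (x - y)) 0 +%R *:%R => //=.
- by move=> x; rewrite subrr; case: subS.
- by move=> x y Sxy; rewrite -opprB -scaleN1r; apply: submodZ.
- by move=> x y t Sxy Syt; rewrite -[x](subrK y) -addrA; apply: submodD.
- by move=> x x' y y' Sx Sy; rewrite opprD addrACA; apply: submodD.
- by move=> a x x' Sx; rewrite -scalerBr; apply: submodZ.
- by move=> x y t; rewrite addrA subrr; case: subS.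
- by move=> x y; rewrite [y + x]addrC subrr; case: subS.
- by move=> x; rewrite add0r subrr; case: subS.
- by move=> x; rewrite scaleN1r addNr subrr; case: subS.
- by move=> a b x; rewrite scalerA subrr; case: subS.
- by move=> x; rewrite scale1r subrr; case: subS.
- by move=> a x y; rewrite scalerDr subrr; case: subS.
- by move=> x a b; rewrite scalerDl subrr; case: subS.
have pl : klinear p by move=> a x y; rewrite pD pZ.
exists Q, p; split=> // x; rewrite -(klin0 pl); split=> [/pE|Sx]; rewrite ?subr0 //.
by apply/pE; rewrite subr0.
Qed.

End Submod.

(* Formal combinations are identified when they agree under every map from T to
   a module, so that the universal property needs no normal form. *)
Lemma free_lmod (T : Type) : exists (F : lmodType k) (b : T -> F),
  forall Z (phi : T -> Z), exists f : F -> Z,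
    [/\ klinear f, forall t, f (b t) = phi t &
        forall f', klinear f' -> (forall t, f' (b t) = phi t) -> f' =1 f].
Proof.
pose ev (Z : lmodType k) (phi : T -> Z) (s : seq (k * T)) := \sum_(p <- s) p.1 *: phi p.2.
pose sc (a : k) (s : seq (k * T)) := [seq (a * p.1, p.2) | p <- s].
have ev_cat Z phi s t : ev Z phi (s ++ t) = ev Z phi s + ev Z phi t by rewrite /ev big_cat.
have ev_sc Z phi a s : ev Z phi (sc a s) = a *: ev Z phi s.
  by rewrite /ev big_map scaler_sumr; apply: eq_bigr => p _; rewrite scalerA.
have [|||||||||||||F [p [psurj pE pD pZ]]] := @setoid_lmodType k (seq (k * T))
    (fun s t => forall (Z : lmodType k) (phi : T -> Z), ev Z phi s = ev Z phi t)
    [::] cat sc => //=.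
- by move=> x y t exy eyt Z phi; rewrite exy.
- by move=> x x' y y' ex ey Z phi; rewrite !ev_cat ex ey.
- by move=> a x x' ex Z phi; rewrite !ev_sc ex.
- by move=> x y t Z phi; rewrite catA.
- by move=> x y Z phi; rewrite !ev_cat addrC.
- by move=> x Z phi; rewrite ev_cat ev_sc scaleN1r addNr /ev big_nil.
- by move=> a b x Z phi; rewrite !ev_sc scalerA.
- by move=> x Z phi; rewrite ev_sc scale1r.
- by move=> a x y Z phi; rewrite !(ev_cat, ev_sc) scalerDr.
- by move=> x a b Z phi; rewrite !(ev_cat, ev_sc) scalerDl.
have [r rK] := choice psurj.
exists F, (fun t => p [:: (1, t)]) => Z phi.
have E s : ev Z phi (r (p s)) = ev Z phi s.
  by have /pE -> := rK (p s).
exists (fun q => ev Z phi (r q)); split.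
- by move=> a x y; rewrite -[in LHS](rK x) -[in LHS](rK y) -pZ -pD E ev_cat ev_sc.
- by move=> t; rewrite E /ev big_seq1 scale1r.
move=> f fl fE x; rewrite -[in LHS](rK x).
elim: (r x) => [|[a t] s IH].
  (* Written as 0 times itself, the empty combination is sent to 0 by linearity. *)
  rewrite /ev big_nil; have -> : [::] = sc 0 [::] by [].
  by rewrite pZ (klinZ fl) scale0r.
have -> : (a, t) :: s = sc a [:: (1, t)] ++ s by rewrite /= mulr1.
by rewrite pD pZ fl IH fE ev_cat ev_sc {2}/ev big_seq1 scale1r.
Qed.

End Linear.

Arguments fmap {k G} V [n m] h x : rename.
Arguments mor {k G V W} f [n] x : rename.
Arguments fmap_lin {k G} V [n m] h _ _ _ : rename.
Arguments lowdeg {k G V n} x.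
Arguments iota {G} n.

(** * Kernels, cokernels and images of FI_G-modules, and the submodules V_{<n} *)

Section FImodTheory.
Variables (k : comPzRingType) (G : groupType).
Notation FImod := (FImod k G).
Implicit Types A B C K L P Q V W Z : FImod.

Lemma mor0 A B (f : FImor A B) n : mor f (0 : fobj A n) = 0.
Proof. exact: (klin0 (@mor_lin _ _ _ _ f n)). Qed.
Lemma morD A B (f : FImor A B) n (x y : fobj A n) : mor f (x + y) = mor f x + mor f y.
Proof. exact: (klinD (@mor_lin _ _ _ _ f n) _ _). Qed.
Lemma morB A B (f : FImor A B) n (x y : fobj A n) : mor f (x - y) = mor f x - mor f y.
Proof. exact: (klinB (@mor_lin _ _ _ _ f n) _ _). Qed.
Lemma morZ A B (f : FImor A B) n a (x : fobj A n) : mor f (a *: x) = a *: mor f x.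
Proof. exact: (klinZ (@mor_lin _ _ _ _ f n) _ _). Qed.
Lemma fmap0 V n m (h : FIhom G n m) : fmap V h 0 = 0.
Proof. exact: (klin0 (fmap_lin V h)). Qed.
Lemma fmapD V n m (h : FIhom G n m) x y : fmap V h (x + y) = fmap V h x + fmap V h y.
Proof. exact: (klinD (fmap_lin V h) _ _). Qed.
Lemma fmapB V n m (h : FIhom G n m) x y : fmap V h (x - y) = fmap V h x - fmap V h y.
Proof. exact: (klinB (fmap_lin V h) _ _). Qed.
Lemma fmapZ V n m (h : FIhom G n m) a x : fmap V h (a *: x) = a *: fmap V h x.
Proof. exact: (klinZ (fmap_lin V h) _ _). Qed.

Lemma mor_inj0 A B (f : FImor A B) :
  (forall n (x : fobj A n), mor f x = 0 -> x = 0) -> mor_inj f.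
Proof. by move=> f0 n; apply: (klin_inj (@mor_lin _ _ _ _ f n)); apply: f0. Qed.

Definition idM V : FImor V V.
Proof. by apply: (@FIMor _ _ V V (fun n x => x)). Defined.

Definition compM A B C (g : FImor B C) (f : FImor A B) : FImor A C.
Proof.
apply: (@FIMor _ _ A C (fun n x => mor g (mor f x))) => [n|n m h x].
  exact: (klin_comp (@mor_lin _ _ _ _ f n) (@mor_lin _ _ _ _ g n)).
by rewrite !mor_nat.
Defined.

Definition zeroM A B : FImor A B.
Proof.
apply: (@FIMor _ _ A B (fun n x => 0)) => [n|n m h x]; first exact: klin_const0.
by rewrite fmap0.
Defined.

Lemma factor_epi A B C (q : FImor A B) (u : FImor A C) : mor_surj q ->
  (forall n (x : fobj A n), mor q x = 0 -> mor u x = 0) ->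
  exists v : FImor B C, forall n (x : fobj A n), mor v (mor q x) = mor u x.
Proof.
move=> qs qu.
have E n : exists v : fobj B n -> fobj C n,
    klinear v /\ forall x, v (mor q x) = mor u x.
  have [v vl vE] := factor_epi_lin (@mor_lin _ _ _ _ q n) (@qs n) (@mor_lin _ _ _ _ u n) (@qu n).
  by exists v.
pose v n := sval (cid (E n)).
have vl n : klinear (v n) by rewrite /v; case: cid => ? [].
have vE n x : v n (mor q x) = mor u x by rewrite /v; case: cid => ? [].
have vn n m h x : v m (fmap B h x) = fmap C h (v n x).
  by have [y <-] := qs n x; rewrite -mor_nat !vE mor_nat.
by exists (FIMor vl vn).
Qed.

Lemma factor_mono A B C (f : FImor A B) (u : FImor C B) : mor_inj f ->
  (forall n (x : fobj C n), exists a, mor f a = mor u x) ->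
  exists v : FImor C A, forall n (x : fobj C n), mor f (mor v x) = mor u x.
Proof.
move=> fI fu.
have E n : exists v : fobj C n -> fobj A n,
    klinear v /\ forall x, mor f (v x) = mor u x.
  have [v vl vE] := factor_mono_lin (@mor_lin _ _ _ _ f n) (@fI n) (@mor_lin _ _ _ _ u n) (@fu n).
  by exists v.
pose v n := sval (cid (E n)).
have vl n : klinear (v n) by rewrite /v; case: cid => ? [].
have vE n x : mor f (v n x) = mor u x by rewrite /v; case: cid => ? [].
have vn n m h x : v m (fmap C h x) = fmap A h (v n x).
  by apply: fI; rewrite mor_nat !vE mor_nat.
by exists (FIMor vl vn).
Qed.

Definition subFI V (S : forall n, fobj V n -> Prop) :=
  (forall n, submod (S n)) /\
  forall n m (h : FIhom G n m) x, S n x -> S m (fmap V h x).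

Lemma sub_FI V (S : forall n, fobj V n -> Prop) : subFI S ->
  exists K (i : FImor K V), mor_inj i /\
    forall n (x : fobj V n), S n x <-> exists y, mor i y = x.
Proof.
move=> [Ss Sf].
have [K KP] := choice (fun n => sub_lmod (Ss n)).
pose i n := sval (cid (KP n)).
have il n : klinear (i n) by rewrite /i; case: cid => ? [].
have iI n : injective (i n) by rewrite /i; case: cid => ? [].
have iS n x : S n x <-> exists y, i n y = x by rewrite /i; case: cid => ? [].
have E n m (h : FIhom G n m) : exists f : K n -> K m,
    klinear f /\ forall x, i m (f x) = fmap V h (i n x).
  have [|f fl fE] := factor_mono_lin (il m) (@iI m) (klin_comp (il n) (fmap_lin V h)).
    by move=> x; apply/iS/Sf/iS; exists x.
  by exists f.
pose f n m h := sval (cid (E n m h)).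
have fl n m h : klinear (f n m h) by rewrite /f; case: cid => ? [].
have fE n m h x : i m (f n m h x) = fmap V h (i n x) by rewrite /f; case: cid => ? [].
have f1 n x : f n n (FIid G n) x = x by apply: iI; rewrite fE fmap_id.
have fc n m p h h' x : f n p (FIcomp h h') x = f m p h (f n m h' x).
  by apply: iI; rewrite !fE fmap_comp.
exists (FIMod fl f1 fc).
by exists (@FIMor _ _ (FIMod fl f1 fc) V i il fE).
Qed.

Lemma quot_FI V (S : forall n, fobj V n -> Prop) : subFI S ->
  exists Q (q : FImor V Q), mor_surj q /\ forall n (x : fobj V n), mor q x = 0 <-> S n x.
Proof.
move=> [Ss Sf].
have [K KP] := choice (fun n => quot_lmod (Ss n)).
pose q n := sval (cid (KP n)).
have ql n : klinear (q n) by rewrite /q; case: cid => ? [].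
have qs n y : exists x, q n x = y by rewrite /q; case: cid => ? [].
have qS n x : q n x = 0 <-> S n x by rewrite /q; case: cid => ? [].
have E n m (h : FIhom G n m) : exists f : K n -> K m,
    klinear f /\ forall x, f (q n x) = q m (fmap V h x).
  have [|f fl fE] := factor_epi_lin (ql n) (@qs n) (klin_comp (fmap_lin V h) (ql m)).
    by move=> x /qS Sx; apply/qS/Sf.
  by exists f.
pose f n m h := sval (cid (E n m h)).
have fl n m h : klinear (f n m h) by rewrite /f; case: cid => ? [].
have fE n m h x : f n m h (q n x) = q m (fmap V h x) by rewrite /f; case: cid => ? [].
have f1 n x : f n n (FIid G n) x = x by have [y <-] := qs n x; rewrite fE fmap_id.
have fc n m p h h' x : f n p (FIcomp h h') x = f m p h (f n m h' x).
  by have [y <-] := qs n x; rewrite !fE fmap_comp.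
exists (FIMod fl f1 fc).
by exists (@FIMor _ _ V (FIMod fl f1 fc) q ql (fun n m h x => esym (fE n m h x))).
Qed.

Lemma ker_subFI A B (f : FImor A B) : subFI (fun n (x : fobj A n) => mor f x = 0).
Proof.
split=> [n|n m h x fx]; last by rewrite mor_nat fx fmap0.
by split=> [|a x y fx fy]; rewrite ?mor0 // mor_lin fx fy scaler0 addr0.
Qed.

Lemma im_subFI A B (f : FImor A B) :
  subFI (fun n (y : fobj B n) => exists x, mor f x = y).
Proof.
split=> [n|n m h y [x <-]]; last by exists (fmap A h x); rewrite mor_nat.
split=> [|a y y' [x <-] [x' <-]]; first by exists 0; rewrite mor0.
by exists (a *: x + x'); rewrite mor_lin.
Qed.

Lemma kernel_ex A B (f : FImor A B) : exists K (i : FImor K A), mor_inj i /\ exact_at i f.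
Proof. by have [K [i iP]] := sub_FI (ker_subFI f); exists K, i. Qed.

Lemma cokernel_ex A B (f : FImor A B) : exists Q (q : FImor B Q), mor_surj q /\ exact_at f q.
Proof. by have [Q [q qP]] := quot_FI (im_subFI f); exists Q, q. Qed.

Lemma image_ex A B (f : FImor A B) : exists I (i : FImor I B) (q : FImor A I),
  [/\ mor_inj i, mor_surj q & forall n (x : fobj A n), mor i (mor q x) = mor f x].
Proof.
have [I [i [iI iS]]] := sub_FI (im_subFI f).
have [|q qE] := factor_mono (u := f) iI; first by move=> n x; apply/iS; exists x.
exists I, i, q; split=> // n y.
have /iS[x fx] : exists z, mor i z = mor i y by exists y.
by exists x; apply: iI; rewrite qE.
Qed.

Lemma short_exact0 A B C (f : FImor A B) (g : FImor B C) n (x : fobj A n) :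
  short_exact f g -> mor g (mor f x) = 0.
Proof. by case=> _ ex _; apply/ex; exists x. Qed.

Lemma short_exact_ker A B (g : FImor A B) : mor_surj g ->
  exists K (i : FImor K A), short_exact i g.
Proof. by move=> gs; have [K [i [iI iE]]] := kernel_ex g; exists K, i. Qed.

Lemma short_exact_coker A B (f : FImor A B) : mor_inj f ->
  exists Q (q : FImor B Q), short_exact f q.
Proof. by move=> fI; have [Q [q [qs qE]]] := cokernel_ex f; exists Q, q. Qed.

Lemma lowdeg_submod V n : submod (lowdeg (V := V) (n := n)).
Proof.
split=> [|a x y Sx Sy]; first exact: lowdeg0.
by apply: lowdegD => //; apply: lowdegZ.
Qed.

Lemma lowdegB V n (x y : fobj V n) : lowdeg x -> lowdeg y -> lowdeg (x - y).
Proof. exact: (submodB (lowdeg_submod V n)). Qed.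

Lemma lowdeg_mor A B (f : FImor A B) n (x : fobj A n) : lowdeg x -> lowdeg (mor f x).
Proof.
elim=> [|m lt_mn h y|u v _ Hu _ Hv|a u _ Hu]; rewrite ?mor0 ?mor_nat ?morD ?morZ.
- exact: lowdeg0.
- exact: lowdeg_im.
- exact: lowdegD.
- exact: lowdegZ.
Qed.

(** Generators are lifted before they are pushed forward. This is the right exactness of H_0. *)
Lemma lowdeg_lift A B (q : FImor A B) n (y : fobj B n) : mor_surj q -> lowdeg y ->
  exists x, lowdeg x /\ mor q x = y.
Proof.
move=> qs; elim=> [|m lt_mn h u|u v _ [x [lx <-]] _ [x' [lx' <-]]|a u _ [x [lx <-]]].
- by exists 0; rewrite mor0; split=> //; apply: lowdeg0.
- have [x <-] := qs m u; exists (fmap A h x); rewrite mor_nat.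
  by split=> //; apply: lowdeg_im.
- by exists (x + x'); rewrite morD; split=> //; apply: lowdegD.
- by exists (a *: x); rewrite morZ; split=> //; apply: lowdegZ.
Qed.

End FImodTheory.

(** * The shift, the derivative [D], and the permanence properties of [T] *)

Section Derivative.
Variables (k : comPzRingType) (G : groupType).
Notation FImod := (FImod k G).
Implicit Types A B C K L P Q V W Z : FImod.

Definition Sh V : FImod.
Proof.
apply: (@FIMod k G (fun n => fobj V n.+1) (fun n m h => fmap V (ext h))).
- by move=> n m h; apply: fmap_lin.
- by move=> n x; rewrite ext_id fmap_id.
- by move=> n m p h h' x; rewrite ext_comp fmap_comp.
Defined.

Definition iotaM V : FImor V (Sh V).
Proof.
apply: (@FIMor _ _ V (Sh V) (fun n => fmap V (iota n))).
- by move=> n; apply: fmap_lin.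
- by move=> n m h x; rewrite -[RHS]fmap_comp ext_iota fmap_comp.
Defined.

Lemma D_ex V : exists Dq : {Q : FImod & FImor (Sh V) Q},
  mor_surj (projT2 Dq) /\ exact_at (iotaM V) (projT2 Dq).
Proof. by have [Q [q qP]] := cokernel_ex (iotaM V); exists (existT _ Q q). Qed.

Definition D V : FImod := projT1 (sval (cid (D_ex V))).
Definition dpi V : FImor (Sh V) (D V) := projT2 (sval (cid (D_ex V))).

(** The types [fobj (Sh V) n] and [fobj V n.+1] are convertible; [dp] is the projection with its
    source in the second form, which keeps [Sh] out of rewriting. *)
Definition dp V n (x : fobj V n.+1) : fobj (D V) n := @mor _ _ _ _ (dpi V) n x.

Lemma dpiP V : mor_surj (dpi V) /\ exact_at (iotaM V) (dpi V).
Proof. exact: svalP (cid (D_ex V)). Qed.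

Lemma dp_lin V n : klinear (@dp V n).
Proof. exact: (@mor_lin _ _ _ _ (dpi V) n). Qed.
Lemma dpD V n (x y : fobj V n.+1) : dp (x + y) = dp x + dp y.
Proof. exact: (klinD (@dp_lin V n)). Qed.
Lemma dpB V n (x y : fobj V n.+1) : dp (x - y) = dp x - dp y.
Proof. exact: (klinB (@dp_lin V n)). Qed.
Lemma dpZ V n a (x : fobj V n.+1) : dp (a *: x) = a *: dp x.
Proof. exact: (klinZ (@dp_lin V n)). Qed.

Lemma dp_surj V n (y : fobj (D V) n) : exists x, dp x = y.
Proof. exact: (dpiP V).1. Qed.

Lemma dp_eq0 V n (x : fobj V n.+1) : dp x = 0 <-> exists y, fmap V (iota n) y = x.
Proof. exact: (dpiP V).2. Qed.

Lemma dp_iota V n (y : fobj V n) : dp (fmap V (iota n) y) = 0.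
Proof. by apply/dp_eq0; exists y. Qed.

Lemma dp_fmap V n m (h : FIhom G n m) (x : fobj V n.+1) :
  fmap (D V) h (dp x) = dp (fmap V (ext h) x).
Proof. exact: esym (mor_nat (dpi V) h x). Qed.

Lemma Dm_ex A B (f : FImor A B) :
  exists g : FImor (D A) (D B), forall n (x : fobj A n.+1), mor g (dp x) = dp (mor f x).
Proof.
have fn n m (h : FIhom G n m) (x : fobj (Sh A) n) :
  mor f (fmap (Sh A) h x) = fmap (Sh B) h (mor f (x : fobj A n.+1)) by apply: mor_nat.
pose Shf : FImor (Sh A) (Sh B) := 
    @FIMor _ _ (Sh A) (Sh B) (fun n => @mor _ _ _ _ f n.+1) (fun n => @mor_lin _ _ _ _ f n.+1) fn.
have [|g gE] := factor_epi (u := compM (dpi B) Shf) (dpiP A).1.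
  move=> n x /dp_eq0[y <-]; apply/dp_eq0; exists (mor f y).
  exact: esym (mor_nat _ _ _).
by exists g => n x; apply: gE.
Qed.

Definition Dm A B (f : FImor A B) : FImor (D A) (D B) := sval (cid (Dm_ex f)).

Lemma DmE A B (f : FImor A B) n (x : fobj A n.+1) : mor (Dm f) (dp x) = dp (mor f x).
Proof. by rewrite /Dm; case: cid. Qed.

Lemma Dm_surj A B (f : FImor A B) : mor_surj f -> mor_surj (Dm f).
Proof.
move=> fs n y; have [z <-] := dp_surj y; have [x <-] := fs _ z.
by exists (dp x); rewrite DmE.
Qed.

(** With [dp_lowdeg] this identifies H_0(D V)_n with H_0(V)_(n+1). A map into [n+1] either factors
    through [iota], whose image [dp] kills, or is [ext h'] after an automorphism, and [dp] turns
    [ext h'] into the action of [h']. *)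
Lemma lowdeg_dp V n (x : fobj V n.+1) : lowdeg x -> lowdeg (dp x).
Proof.
elim=> [|m lt_mn h y|u v _ Hu _ Hv|a u _ Hu].
- by rewrite (klin0 (@dp_lin V n)); apply: lowdeg0.
- have [[h' ->]|[z hz]] := FIhom_case h.
    by rewrite fmap_comp dp_iota; apply: lowdeg0.
  case: m => [|m] in lt_mn h y z hz *; first by have := ltn_ord z.
  have [h' [s ->]] := FIhom_hit hz.
  by rewrite fmap_comp -dp_fmap; apply: lowdeg_im.
- by rewrite dpD; apply: lowdegD.
- by rewrite dpZ; apply: lowdegZ.
Qed.

(** Each generator of the low part of [D V] lifts to a low element of [V]; the error lies in the
    image of [iota], which is low as well. *)
Lemma dp_lowdeg V n (x : fobj V n.+1) : lowdeg (dp x) -> lowdeg x.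
Proof.
move dE: (dp x) => d ld; elim: ld x dE => {d} [|m lt_mn h y|u v _ Hu _ Hv|a u _ Hu] x.
- by move/dp_eq0=> [y <-]; apply: lowdeg_im.
- have [z <-] := dp_surj y; rewrite dp_fmap => /eqP; rewrite -subr_eq0 -dpB => /eqP.
  move/dp_eq0=> [w E]; rewrite -[x](subrK (fmap V (ext h) z)) -E.
  by apply: lowdegD; apply: lowdeg_im.
- have [z zu] := dp_surj u => xE; rewrite -[x](subrK z); apply: lowdegD; last exact: Hu.
  by apply: Hv; rewrite dpB xE zu addrC addKr.
- have [z zu] := dp_surj u => /eqP; rewrite -zu -dpZ -subr_eq0 -dpB => /eqP.
  move/dp_eq0=> [w E]; rewrite -[x](subrK (a *: z)) -E.
  by apply: lowdegD; [apply: lowdeg_im | apply: lowdegZ; apply: Hu].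
Qed.

Definition tf V := forall n (x : fobj V n), fmap V (iota n) x = 0 -> x = 0.
Definition T V := forall b, tf (iter b D V).

Lemma T_tf V : T V -> tf V. Proof. by move/(_ 0%N). Qed.
Lemma T_D V : T V -> T (D V). Proof. by move=> TV b; rewrite -iterSr. Qed.

Lemma iota_mor A B (f : FImor A B) n (x : fobj A n) :
  mor f (fmap A (iota n) x) = fmap B (iota n) (mor f x).
Proof. exact: mor_nat. Qed.

Lemma mor_inj_eq0 A B (f : FImor A B) : mor_inj f ->
  forall n (x : fobj A n), mor f x = 0 -> x = 0.
Proof. by move=> fI n x fx; apply: fI; rewrite mor0. Qed.

Lemma tf_sub A B (f : FImor A B) : mor_inj f -> tf B -> tf A.
Proof.
move=> fI tB n x ix; apply: (mor_inj_eq0 fI); apply: tB.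
by rewrite -iota_mor ix mor0.
Qed.

(** This is the snake lemma for [iota] on the three terms: the connecting map starts at the kernel
    of [iota] on [C], which is zero. *)
Lemma D_exact A B C (f : FImor A B) (g : FImor B C) :
  short_exact f g -> tf C -> short_exact (Dm f) (Dm g).
Proof.
move=> [fI ex gs] tC; split.
- apply: mor_inj0 => n u; have [a <-] := dp_surj u; rewrite DmE => /dp_eq0[b E].
  have /ex[a' a'E] : mor g b = 0.
    by apply: tC; rewrite -iota_mor E; apply/ex; exists a.
  apply/dp_eq0; exists a'; apply: fI; by rewrite iota_mor a'E.
- move=> n u; split=> [|[a <-]].
    have [b <-] := dp_surj u; rewrite DmE => /dp_eq0[c E].
    have [b' b'E] := gs _ c.
    have /ex[a aE] : mor g (b - fmap B (iota n) b') = 0.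
      by rewrite morB iota_mor b'E E subrr.
    by exists (dp a); rewrite DmE aE dpB dp_iota subr0.
  have [a' <-] := dp_surj a; rewrite !DmE.
  have -> : mor g (mor f a') = 0 by apply/ex; exists a'.
  by rewrite (klin0 (@dp_lin _ _)).
- exact: Dm_surj.
Qed.

(** All derived sequences stay exact because the iterated derivatives of [C] are torsion-free, so
    only torsion-freeness of a middle term has to be checked. *)
Lemma T_ext A B C (f : FImor A B) (g : FImor B C) : short_exact f g -> T A -> T C -> T B.
Proof.
move=> se TA TC b; elim: b A B C f g se TA TC => [|b IH] A B C f g se TA TC; last first.
  by rewrite iterSr; apply: (IH _ _ _ _ _ (D_exact se (T_tf TC))); apply: T_D.
move=> n x /= ix; have [fI ex _] := se.
have /ex[a aE] : mor g x = 0 by apply: (T_tf TC); rewrite -iota_mor ix mor0.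
rewrite -aE; suff -> : a = 0 by rewrite mor0.
by apply: (T_tf TA); apply: (mor_inj_eq0 fI); rewrite iota_mor aE.
Qed.

Lemma T_ker A B C (f : FImor A B) (g : FImor B C) : short_exact f g -> T B -> T C -> T A.
Proof.
move=> se TB TC b; elim: b A B C f g se TB TC => [|b IH] A B C f g se TB TC.
  by case: se => fI _ _; apply: tf_sub fI (T_tf TB).
by rewrite iterSr; apply: (IH _ _ _ _ _ (D_exact se (T_tf TC))); apply: T_D.
Qed.

Lemma tf_coker A B C (f : FImor A B) (g : FImor B C) :
  short_exact f g -> tf (D A) -> tf B -> tf C.
Proof.
move=> [fI ex gs] tDA tB n c ic; have [b bE] := gs _ c.
have /ex[a aE] : mor g (fmap B (iota n) b) = 0 by rewrite iota_mor bE.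
(* The image of [a] in [B] comes from degree n, where [ext_iota] equates the two composites into
   degree n + 2. So [iota] and [ext (iota n)] agree on [a], and [iota] kills [dp a]. *)
have /dp_eq0[a' a'E] : dp a = 0.
  apply: tDA; rewrite dp_fmap; apply/dp_eq0; exists a; apply: fI.
  by rewrite !mor_nat aE -!fmap_comp ext_iota.
rewrite -bE; apply/ex; exists a'; apply/subr0_eq/tB.
by rewrite fmapB -iota_mor a'E aE subrr.
Qed.

(** Differentiating the sequence requires [C] to be torsion-free; [tf_coker] provides this from [A]
    taken one derivative further. *)
Lemma T_coker A B C (f : FImor A B) (g : FImor B C) : short_exact f g -> T A -> T B -> T C.
Proof.
move=> se TA TB b; elim: b A B C f g se TA TB => [|b IH] A B C f g se TA TB.
  exact: tf_coker se (T_tf (T_D TA)) (T_tf TB).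
rewrite iterSr; apply: (IH _ _ _ (Dm f) (Dm g)); try exact: T_D.
exact: D_exact se (tf_coker se (T_tf (T_D TA)) (T_tf TB)).
Qed.

Lemma T_retract A B (s : FImor A B) (r : FImor B A) :
  (forall n (x : fobj A n), mor r (mor s x) = x) -> T B -> T A.
Proof.
move=> rs TB b; elim: b A B s r rs TB => [|b IH] A B s r rs TB.
  by apply: tf_sub (T_tf TB) => n; apply: can_inj (rs n).
rewrite iterSr; apply: (IH _ _ (Dm s) (Dm r)) (T_D TB) => n x.
by have [y <-] := dp_surj x; rewrite !DmE rs.
Qed.

Lemma T_zero V : is_zero V -> T V.
Proof.
move=> V0 b; elim: b V V0 => [|b IH] V V0; first by move=> n x _; apply: V0.
rewrite iterSr; apply: IH => n x; have [y <-] := dp_surj x.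
by rewrite (V0 _ y) (klin0 (@dp_lin _ _)).
Qed.

(* H_1(V) = 0: the kernel of any surjection onto V injects on H_0. *)
Definition acyc1 V := forall A B (f : FImor A B) (g : FImor B V), short_exact f g ->
  forall n (a : fobj A n), lowdeg (mor f a) -> lowdeg a.

Lemma lowdeg_deg0 V (x : fobj V 0) : lowdeg x -> x = 0.
Proof. by elim=> [|//|u v _ -> _ ->|a u _ ->]; rewrite ?addr0 ?scaler0. Qed.

(* For torsion-free V, H_1(D V) in degree n is H_1(V) in degree n + 1. *)
Lemma T_acyc1 V : T V -> acyc1 V.
Proof.
move=> TV A B f g se n; elim: n V A B f g se TV => [|n IH] V A B f g se TV a la.
  have -> : a = 0 by apply: (mor_inj_eq0 (f := f)); [case: se | apply: lowdeg_deg0].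
  exact: lowdeg0.
apply: dp_lowdeg; apply: (IH _ _ _ _ _ (D_exact se (T_tf TV)) (T_D TV)).
by rewrite DmE; apply: lowdeg_dp.
Qed.

End Derivative.

(** * Relatively projective modules have property [T] *)

Section RelProjective.
Variables (k : comPzRingType) (G : groupType).
Notation FImod := (FImod k G).

Section IsM.
Variables (V : FImod) (W : FBmod k G).
Variable Phi : forall n m, bobj W n -> FIhom G n m -> fobj V m.
Hypothesis VM : is_M_of Phi.

Lemma is_M_ext m (Z : lmodType k) (f f' : fobj V m -> Z) : klinear f -> klinear f' ->
  (forall n w (h : FIhom G n m), f (Phi w h) = f' (Phi w h)) -> f =1 f'.
Proof.
move=> fl fl' E; case: VM => Pl Pb _ /(_ m Z (fun n w h => f' (Phi w h)))[||g [_ _ gu]].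
- by move=> n h; apply: (klin_comp (Pl n m h) fl').
- by move=> n h s w; rewrite Pb.
by move=> x; rewrite (gu f) // (gu f').
Qed.

(** In each degree [iota] has a linear left inverse: it undoes [iota] on the generators whose map
    factors through [iota] and kills the others. It is well defined because automorphisms of the
    source preserve this dichotomy. *)
Lemma is_M_tf : tf V.
Proof.
case: VM => Pl Pb Pn Pu m.
pose psi n (w : bobj W n) (h : FIhom G n m.+1) : fobj V m :=
  if pselect (exists h', h = FIcomp (iota m) h') is left H then Phi w (sval (cid H)) else 0.
have psiE n w (h : FIhom G n m) : psi n w (FIcomp (iota m) h) = Phi w h.
  rewrite /psi; case: pselect => [H|[]]; last by exists h.
  by case: cid => h' /= /iota_inj ->.
have psi0 n w (h : FIhom G n m.+1) : ~ (exists h', h = FIcomp (iota m) h') -> psi n w h = 0.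
  by rewrite /psi; case: pselect.
have [||f [fl fE _]] := Pu m.+1 _ psi.
- move=> n h; case: (pselect (exists h', h = FIcomp (iota m) h')) => [[h' ->]|nh] a x y.
    by rewrite !psiE Pl.
  by rewrite !psi0 // scaler0 addr0.
- move=> n h s w; case: (pselect (exists h', h = FIcomp (iota m) h')) => [[h' ->]|nh].
    by rewrite -FIcompA !psiE Pb.
  rewrite !psi0 // => -[h' E]; have [t [_ st]] := FIinv s.
  by apply: nh; exists (FIcomp h' t); rewrite FIcompA -E -FIcompA st FIcomph1.
have fK : (fun x => f (fmap V (iota m) x)) =1 id.
  apply: is_M_ext => // [|n w h]; first by apply: (klin_comp (fmap_lin V (iota m)) fl).
  by rewrite Pn fE psiE.
by move=> x ix; rewrite -[x]fK ix (klin0 fl).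
Qed.

Definition shiftB : FBmod k G.
Proof.
apply: (@FBMod k G (fun n => bobj W n.+1) (fun n s => @bact _ _ W n.+1 (ext s))).
- by move=> n s; apply: bact_lin.
- by move=> n w; rewrite ext_id bact_id.
- by move=> n s t w; rewrite ext_comp bact_comp.
Defined.

(* D M(W) = M(W'), where W'_n is the restriction of W_{n+1} along
   G_n -> G_{n+1}: the maps [n+1] -> [m+1] hitting the last point are those of
   the form (h + id) o s, and the others factor through iota. *)
Lemma is_M_D : rel_projective (D V).
Proof.
case: VM => Pl Pb Pn Pu.
exists shiftB, (fun n m (w : bobj shiftB n) h => dp (Phi (w : bobj W n.+1) (ext h))); split.
- by move=> n m h; apply: (klin_comp (Pl n.+1 m.+1 (ext h)) (@dp_lin _ _ V m)).
- by move=> n m h s w; rewrite ext_comp Pb.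
- by move=> n m p h' h w; rewrite dp_fmap Pn ext_comp.
move=> m Z psi psil psib.
pose hits n (h : FIhom G n.+1 m.+1) :=
  exists hs : FIhom G n m * FIhom G n.+1 n.+1, h = FIcomp (ext hs.1) hs.2.
(* This extends [psi] from maps hitting the last point to all maps, by 0 on those factoring through
   [iota]. For n = 0 no map hits a point. *)
pose psi' n : bobj W n -> FIhom G n m.+1 -> Z :=
  if n is n'.+1 return bobj W n -> FIhom G n m.+1 -> Z then fun w h =>
    if pselect (hits n' h) is left H
    then psi n' (bact (sval (cid H)).2 w) (sval (cid H)).1 else 0
  else fun _ _ => 0.
have psiE n w (h : FIhom G n m) s : psi' n.+1 w (FIcomp (ext h) s) = psi n (bact s w) h.
  rewrite /psi'; case: pselect => [H|[]]; last by exists (h, s).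
  case: cid => -[h' s'] /= /esym/ext_decomp_uniq[r [-> ->]].
  by rewrite psib /= bact_comp.
have psi0 n w (h : FIhom G n m) : psi' n w (FIcomp (iota m) h) = 0.
  case: n => [//|n] in w h *; rewrite /psi'; case: pselect => // H; exfalso.
  by case: H => -[h' s] /= /iota_neq_ext.
have hitP n (h : FIhom G n m.+1) (P : forall n, FIhom G n m.+1 -> Prop) :
    (forall n h, P n (FIcomp (iota m) h)) ->
    (forall n (h : FIhom G n m) (s : FIhom G n.+1 n.+1), P n.+1 (FIcomp (ext h) s)) -> P n h.
  move=> P1 P2; have [[h' ->]|[z hz]] := FIhom_case h; first exact: P1.
  case: n h z hz => [|n] h z hz; first by have := ltn_ord z.
  by have [h1 [s ->]] := FIhom_hit hz; apply: P2.
have [||f [fl fE _]] := Pu m.+1 Z psi'.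
- move=> n h; elim/hitP: h => {}n h; first by move=> a x y; rewrite !psi0 scaler0 addr0.
  by move=> s a x y; rewrite !psiE bact_lin psil.
- move=> n h; elim/hitP: h => {}n h s; first by move=> w; rewrite -FIcompA !psi0.
  by move=> t w; rewrite -FIcompA !psiE bact_comp.
(* Vanishing on the image of [iota] lets [f] descend to the cokernel [D V]. *)
have fi x : f (fmap V (iota m) x) = 0.
  apply: (is_M_ext (f' := fun _ => 0) (klin_comp (fmap_lin V (iota m)) fl)) => [|n w h].
    exact: klin_const0.
  by rewrite Pn fE psi0.
have [|g gl gE] := factor_epi_lin (@dp_lin _ _ V m) (@dp_surj _ _ V m) fl.
  by move=> x /dp_eq0[y <-].
have psi1 n (w : bobj W n.+1) (h : FIhom G n m) : psi' n.+1 w (ext h) = psi n w h.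
  by rewrite -[ext h]FIcomph1 psiE bact_id.
exists g; split=> // [n w h|g' gl' gE' x]; first by rewrite gE fE psi1.
have [y <-] := dp_surj x; rewrite gE.
move: y; apply: is_M_ext => // [|n w h].
  exact: (klin_comp (@dp_lin _ _ V m) gl').
rewrite fE; elim/hitP: h w => {}n h; first by move=> w; rewrite -Pn dp_iota psi0 (klin0 gl').
by move=> s w; rewrite Pb gE' psiE.
Qed.

End IsM.

Lemma rel_projective_T (V : FImod) : rel_projective V -> T V.
Proof.
move=> VM b; elim: b V VM => [|b IH] V [W [Phi VM]]; first exact: is_M_tf VM.
by rewrite iterSr; apply: IH; apply: is_M_D VM.
Qed.

(** This criterion recognizes [V] as M(S) for G_n-stable submodules [S n] of V_n, without building
    an FB_G-module each time. Here [psi] is defined on all of V_n, but only its restriction to [S]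
    is constrained. *)
Lemma rel_projective_sub (V : FImod) (S : forall n, fobj V n -> Prop) :
  (forall n, submod (S n)) ->
  (forall n (s : FIhom G n n) x, S n x -> S n (fmap V s x)) ->
  (forall m (Z : lmodType k) (psi : forall n, fobj V n -> FIhom G n m -> Z),
     (forall n h a x y, S n x -> S n y -> psi n (a *: x + y) h = a *: psi n x h + psi n y h) ->
     (forall n h s x, S n x -> psi n x (FIcomp h s) = psi n (fmap V s x) h) ->
     exists2 f : fobj V m -> Z, klinear f & forall n x h, S n x -> f (fmap V h x) = psi n x h) ->
  (forall m (Z : lmodType k) (f : fobj V m -> Z), klinear f ->
     (forall n x h, S n x -> f (fmap V h x) = 0) -> forall x, f x = 0) ->
  rel_projective V.
Proof.
move=> Ss Sf ex un.
have [B BP] := boolp.choice (fun n => sub_lmod (Ss n)).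
pose i n := sval (cid (BP n)).
have il n : klinear (i n) by rewrite /i; case: cid => ? [].
have iI n : injective (i n) by rewrite /i; case: cid => ? [].
have iS n x : S n x <-> exists y, i n y = x by rewrite /i; case: cid => ? [].
have iSx n x : S n (i n x) by apply/iS; exists x.
have E n (h : FIhom G n n) : exists f : B n -> B n,
    klinear f /\ forall x, i n (f x) = fmap V h (i n x).
  have [|f fl fE] := factor_mono_lin (il n) (@iI n) (klin_comp (il n) (fmap_lin V h)).
    by move=> x; apply/iS/Sf/iS; exists x.
  by exists f.
pose f n h := sval (cid (E n h)).
have fl n h : klinear (f n h) by rewrite /f; case: cid => ? [].
have fE n h x : i n (f n h x) = fmap V h (i n x) by rewrite /f; case: cid => ? [].
have f1 n x : f n (FIid G n) x = x by apply: iI; rewrite fE fmap_id.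
have fc n h h' x : f n (FIcomp h h') x = f n h (f n h' x).
  by apply: iI; rewrite !fE fmap_comp.
exists (FBMod fl f1 fc), (fun n m w h => fmap V h (i n w)); split.
- by move=> n m h; apply: (klin_comp (il n) (fmap_lin V h)).
- by move=> n m h s w /=; rewrite fE fmap_comp.
- by move=> n m p h' h w; rewrite fmap_comp.
move=> m Z psi psil psib.
pose psi' n x h := if pselect (exists y, i n y = x) is left H then psi n (sval (cid H)) h else 0.
have psiE n y h : psi' n (i n y) h = psi n y h.
  rewrite /psi'; case: pselect => [H|[]]; last by exists y.
  by case: cid => y' /= /iI ->.
have [||g gl gE] := ex m Z psi'.
- by move=> n h a x y /iS[x' <-] /iS[y' <-]; rewrite -il !psiE psil.
- by move=> n h s x /iS[x' <-]; rewrite -fE !psiE psib.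
exists g; split=> // [n w h|g' gl' gE' x]; first by rewrite gE ?psiE.
apply/subr0_eq; apply: (un m Z (fun x => g' x - g x)) => [a u v|n u h /iS[w <-]].
  by rewrite gl gl' scalerBr opprD addrACA.
by rewrite gE' gE // psiE subrr.
Qed.

End RelProjective.

(** * Free modules, covers and generation degree *)

Section Free.
Variables (k : comPzRingType) (G : groupType).
Notation FImod := (FImod k G).

(** Generation is expressed as vanishing of H_0 from degree m on. With a strict bound, m = 0 means
    that [V] is zero, where the inductions on m start. *)
Definition gen_lt m (V : FImod) := forall n, (m <= n)%N -> forall x : fobj V n, lowdeg x.

Section Basis.
Variables (P : FImod) (I : Type) (deg : I -> nat) (e : forall i, fobj P (deg i)).

(** Unlike [free_on], which only tests morphisms of FI_G-modules, this asks that each P_m be the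
    free k-module on the translates of the generators, and so gives linear maps out of a single
    degree. *)
Definition kfree := forall m (Z : lmodType k) (psi : forall i, FIhom G (deg i) m -> Z),
  exists f : fobj P m -> Z, [/\ klinear f, forall i h, f (fmap P h (e i)) = psi i h &
    forall f', klinear f' -> (forall i h, f' (fmap P h (e i)) = psi i h) -> f' =1 f].

Hypothesis Pfree : kfree.

Lemma kfree_ext m (Z : lmodType k) (f f' : fobj P m -> Z) : klinear f -> klinear f' ->
  (forall i h, f (fmap P h (e i)) = f' (fmap P h (e i))) -> f =1 f'.
Proof.
move=> fl fl' E; have [g [_ _ gu]] := Pfree (fun i h => f' (fmap P h (e i))).
by move=> x; rewrite (gu f) // (gu f').
Qed.

Lemma kfree_map (U : FImod) (u : forall i, fobj U (deg i)) :
  exists f : FImor P U, forall i, mor f (e i) = u i.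
Proof.
pose ex m := @Pfree m (fobj U m) (fun i h => fmap U h (u i)).
pose f m := sval (cid (ex m)).
have fl m : klinear (f m) by rewrite /f; case: cid => ? [].
have fE m i h : f m (fmap P h (e i)) = fmap U h (u i) by rewrite /f; case: cid => ? [].
have fn n m h x : f m (fmap P h x) = fmap U h (f n x).
  apply: (kfree_ext (f := fun x => f m (fmap P h x)) (f' := fun x => fmap U h (f n x))).
  - exact: (klin_comp (fmap_lin P h) (fl m)).
  - exact: (klin_comp (fl n) (fmap_lin U h)).
  by move=> i h'; rewrite -fmap_comp !fE fmap_comp.
by exists (FIMor fl fn) => i /=; rewrite -[e i]fmap_id fE fmap_id.
Qed.

Lemma kfree_eq (U : FImod) (f g : FImor P U) : (forall i, mor f (e i) = mor g (e i)) ->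
  forall n (x : fobj P n), mor f x = mor g x.
Proof.
move=> E n; apply: (kfree_ext (@mor_lin _ _ _ _ f n) (@mor_lin _ _ _ _ g n)) => i h.
by rewrite !mor_nat E.
Qed.

Lemma kfree_projective : projective P.
Proof.
move=> U U' p a ps.
pose u i := sval (cid (ps _ (mor a (e i)))).
have uE i : mor p (u i) = mor a (e i) by rewrite /u; case: cid.
have [b bE] := kfree_map u; exists b => n x.
by rewrite -[LHS]/(mor (compM p b) x); apply: kfree_eq => i /=; rewrite bE uE.
Qed.

Lemma kfree_gen_lt m : (forall i, (deg i < m)%N) -> gen_lt m P.
Proof.
move=> dm n mn x; have [Q [q [ql _ q0]]] := quot_lmod (lowdeg_submod P n).
apply/q0; apply: (kfree_ext ql (@klin_const0 _ _ _)) => i h; apply/q0.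
by apply: lowdeg_im; apply: leq_trans mn.
Qed.

(** In degree n this is the k[G_n]-submodule spanned by the generators of that degree; these
    submodules form the FB_G-module W with P = M(W). *)
Inductive gspan : forall n, fobj P n -> Prop :=
  | gspan0 n : @gspan n 0
  | gspan_gen i (s : FIhom G (deg i) (deg i)) : gspan (fmap P s (e i))
  | gspan_lin n a (x y : fobj P n) : gspan x -> gspan y -> gspan (a *: x + y).

Lemma kfree_rel_projective : rel_projective P.
Proof.
apply: (@rel_projective_sub _ _ P gspan).
- by move=> n; split; [apply: gspan0 | move=> a x y; apply: gspan_lin].
- move=> n s x Sx; elim: Sx s => {n x} [n|i t|n a x y _ IHx _ IHy] s.
  + by rewrite fmap0; apply: gspan0.
  + by rewrite -fmap_comp; apply: gspan_gen.
  + by rewrite fmap_lin; apply: gspan_lin.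
- move=> m Z psi psil psib.
  have [f [fl fE _]] := Pfree (fun i h => psi _ (e i) h).
  have Se i : gspan (e i) by rewrite -[e i]fmap_id; apply: gspan_gen.
  exists f => // n x h Sx; elim: Sx h => {n x} [n|i s|n a x y Sx IHx Sy IHy] h.
  + have S0 := gspan0 n; have := psil n h 1 0 0 S0 S0.
    by rewrite !scale1r addr0 -{1}[psi n 0 h]addr0 => /addrI <-; rewrite fmap0 (klin0 fl).
  + by rewrite -fmap_comp fE psib.
  + by rewrite fmap_lin fl IHx IHy psil.
- move=> m Z f fl f0; apply: kfree_ext => //; first exact: klin_const0.
  by move=> i h; rewrite f0 //; rewrite -[e i]fmap_id; apply: gspan_gen.
Qed.

End Basis.

Lemma kfree_ex (I : Type) (deg : I -> nat) :
  exists (P : FImod) (e : forall i, fobj P (deg i)), kfree e.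
Proof.
pose Tm m := {i & FIhom G (deg i) m}.
have [F FP] := boolp.choice (fun m => free_lmod k (Tm m)).
pose b m := sval (cid (FP m)).
have bP m (Z : lmodType k) (phi : Tm m -> Z) : exists f : F m -> Z,
    [/\ klinear f, forall t, f (b m t) = phi t &
        forall f', klinear f' -> (forall t, f' (b m t) = phi t) -> f' =1 f].
  by rewrite /b; case: cid => ? /=.
have bext m (Z : lmodType k) (f f' : F m -> Z) : klinear f -> klinear f' ->
    (forall t, f (b m t) = f' (b m t)) -> f =1 f'.
  by move=> fl fl' E x; have [g [_ _ gu]] := bP m Z (f' \o b m); rewrite (gu f) // (gu f').
pose act n m (h : FIhom G n m) (t : Tm n) : Tm m := Tagged _ (FIcomp h (tagged t)).
pose f n m h := sval (cid (bP n (F m) (b m \o act n m h))).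
have fl n m h : klinear (f n m h) by rewrite /f; case: cid => ? [].
have fE n m h t : f n m h (b n t) = b m (act n m h t) by rewrite /f; case: cid => ? [].
have f1 n x : f n n (FIid G n) x = x.
  by move: x; apply: bext => // -[i h]; rewrite fE /act /= FIcomp1h.
have fc n m p h h' x : f n p (FIcomp h h') x = f m p h (f n m h' x).
  move: x; apply: bext => //; first exact: (klin_comp (fl n m h') (fl m p h)).
  by case=> i g; rewrite !fE /act /= FIcompA.
pose P := FIMod fl f1 fc.
exists P, (fun i => b (deg i) (Tagged _ (FIid G (deg i)))) => m Z psi.
have eE i (h : FIhom G (deg i) m) :
    fmap P h (b (deg i) (Tagged _ (FIid G (deg i)))) = b m (Tagged _ h).
  by rewrite /= fE /act /= FIcomph1.
have [g [gl gE gu]] := bP m Z (fun t => psi (tag t) (tagged t)).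
exists g; split=> // [i h|g' gl' gE']; first by rewrite eE gE.
by apply: gu => // -[i h]; rewrite -eE gE'.
Qed.

(** Only the elements outside V_{<n} are taken as generators. Hence the cover has no generators in
    degrees where H_0(V) vanishes, and strong induction on the degree still gives surjectivity. *)
Lemma cover_ex (V : FImod) : exists (P : FImod) (p : FImor P V),
  [/\ mor_surj p, projective P, T P & forall m, gen_lt m V -> gen_lt m P].
Proof.
pose I := {nx : {n & fobj V n} | ~ lowdeg (tagged nx)}.
have [P [e Pfree]] := @kfree_ex I (fun i => tag (sval i)).
have [p pE] := kfree_map Pfree (fun i => tagged (sval i)).
exists P, p; split.
- move=> n; elim/ltn_ind: n => n IH y.
  case: (pselect (lowdeg y)) => [|ny]; last first.
    pose i : I := exist _ (existT (fun n => fobj V n : Type) n y) ny.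
    by exists (e i); apply: (pE i).
  elim=> [|m lt_mn h u|u v _ [x <-] _ [x' <-]|a u _ [x <-]].
  + by exists 0; rewrite mor0.
  + by have [x <-] := IH m lt_mn u; exists (fmap P h x); rewrite mor_nat.
  + by exists (x + x'); rewrite morD.
  + by exists (a *: x); rewrite morZ.
- exact: kfree_projective Pfree.
- exact: rel_projective_T (kfree_rel_projective Pfree).
- move=> m Vm; apply: (kfree_gen_lt Pfree) => -[[n x] /= nx].
  by rewrite ltnNge; apply/negP => mn; apply: nx; apply: Vm.
Qed.

(** A projective module is a direct summand of its cover, which is free. *)
Lemma projective_T (P : FImod) : projective P -> T P.
Proof.
move=> Pp; have [F [p [ps _ TF _]]] := cover_ex P.
by have [s sE] := Pp _ _ p (idM P) ps; apply: T_retract sE TF.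
Qed.

Lemma gen_in_deg_lt (V : FImod) m : gen_in_deg V m -> gen_lt m.+1 V.
Proof.
move=> [P [I [deg [e [Pf dm [p ps]]]]]] n mn y; have [x <-] := ps n y.
apply: lowdeg_mor.
(* Only the universal property of [P] is known, so [P] is compared with the degreewise free module
   [F] on the same degrees: the identity of [P] factors through [F]. *)
have [F [b Ff]] := kfree_ex deg.
have [f fE] := kfree_map Ff e; have [g [gE _]] := Pf F b.
have [h [hE hu]] := Pf P e.
have -> : x = mor f (mor g x).
  rewrite -[LHS]/(mor (idM P) x) -[RHS]/(mor (compM f g) x).
  by rewrite (hu (idM P)) // (hu (compM f g)) // => i /=; rewrite gE fE.
by apply: lowdeg_mor; apply: (kfree_gen_lt Ff) mn _ => i; apply: dm.
Qed.

Definition fg (V : FImod) := exists m, gen_lt m V.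

Lemma gen_finite_fg (V : FImod) : gen_finite V -> fg V.
Proof. by move=> [m /gen_in_deg_lt Vm]; exists m.+1. Qed.

End Free.

(** * From vanishing of H_1 to a filtration with relatively projective quotients *)

Section AcyclicFiltration.
Variables (k : comPzRingType) (G : groupType).
Notation FImod := (FImod k G).
Implicit Types A B C K L P Q U V W X Z : FImod.

(** Here [L] is the preimage of [X] in [P]: it is both the kernel of P -> Q and an extension of [X]
    by [K]. *)
Lemma preimage_ex X V Q K P (i : FImor X V) (q : FImor V Q) (j : FImor K P) (p : FImor P V) :
  short_exact i q -> short_exact j p ->
  exists L (l : FImor L P) (c : FImor K L) (r : FImor L X),
    [/\ short_exact l (compM q p), short_exact c r,
        forall n (x : fobj K n), mor l (mor c x) = mor j x &
        forall n (y : fobj L n), mor i (mor r y) = mor p (mor l y)].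
Proof.
move=> [iI iq qs] [jI jp ps].
have [|L [l [lI lq ls]]] := @short_exact_ker _ _ _ _ (compM q p).
  by move=> n z; have [y <-] := qs n z; have [x <-] := ps n y; exists x.
have [|r rE] := factor_mono (u := compM p l) iI.
  by move=> n x; apply/iq/(lq n); exists x.
have [|c cE] := factor_mono (u := j) lI.
  move=> n x; apply/lq => /=; have -> : mor p (mor j x) = 0 by apply/jp; exists x.
  by rewrite mor0.
exists L, l, c, r; split=> //; split.
- by apply: mor_inj0 => n x cx; apply: (mor_inj_eq0 jI); rewrite -cE cx mor0.
- move=> n y; split=> [ry|[x <-]].
    have /jp[x xE] : mor p (mor l y) = 0 by rewrite -[LHS]rE ry mor0.
    by exists x; apply: lI; rewrite cE.
  by apply: (mor_inj_eq0 iI); rewrite rE /= cE; apply/jp; exists x.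
- move=> n x; have [z zE] := ps n (mor i x).
  have /lq[y yE] : mor (compM q p) z = 0 by rewrite /= zE; apply/iq; exists x.
  by exists y; apply: iI; rewrite rE /= yE.
Qed.

(** Lifting [p] through [g] gives P -> B, and [c] is the induced map of kernels. Modulo low
    elements, whatever in [A] becomes low in [B] comes from an element of [K] that becomes low in
    [P], so one projective presentation controls all others. *)
Lemma compare V K P A B (i : FImor K P) (p : FImor P V) (f : FImor A B) (g : FImor B V) :
  projective P -> short_exact i p -> short_exact f g ->
  exists c : FImor K A, forall n (a : fobj A n), lowdeg (mor f a) ->
    exists x a', [/\ lowdeg (mor i x), lowdeg a' & a = a' + mor c x].
Proof.
move=> Pp [iI ip ps] [fI fg gs]; have [phi phiE] := Pp _ _ g p gs.
have [|c cE] := factor_mono (u := compM phi i) fI.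
  by move=> n x; apply/fg; rewrite /= phiE; apply/ip; exists x.
exists c => n a.
have lift (b : fobj B n) : lowdeg b -> exists z a',
    [/\ lowdeg z, lowdeg a' & b = mor f a' + mor phi z].
  elim=> [|m lt_mn h y|u v _ [z [a1 [lz la ->]]] _ [z' [a1' [lz' la' ->]]]|s u _ [z [a1 [lz la ->]]]].
  - by exists 0, 0; rewrite !mor0 addr0; split=> //; apply: lowdeg0.
  - have [z zE] := ps m (mor g y).
    have /fg[a1 aE] : mor g (y - mor phi z) = 0 by rewrite morB phiE zE subrr.
    exists (fmap P h z), (fmap A h a1); split; try exact: lowdeg_im.
    by rewrite !mor_nat -fmapD aE subrK.
  - exists (z + z'), (a1 + a1'); split; try exact: lowdegD.
    by rewrite !morD addrACA.
  - exists (s *: z), (s *: a1); split; try exact: lowdegZ.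
    by rewrite !morZ scalerDr.
move=> /lift[z [a' [lz la' E]]].
have /ip[x xE] : mor p z = 0.
  have -> : mor p z = mor g (mor f (a - a')).
    by rewrite -phiE morB E addrC addKr.
  by apply/fg; exists (a - a').
exists x, a'; split; rewrite ?xE //.
by apply: fI; rewrite morD cE /= xE.
Qed.

Lemma acyc1_cover V K P (i : FImor K P) (p : FImor P V) : projective P -> short_exact i p ->
  (forall n (x : fobj K n), lowdeg (mor i x) -> lowdeg x) -> acyc1 V.
Proof.
move=> Pp se pure A B f g se' n a la; have [c cP] := compare Pp se se'.
have [x [a' [lx la' ->]]] := cP n a la.
by apply: lowdegD => //; apply/lowdeg_mor/pure.
Qed.

(** In the long exact sequence, H_1(V) sits between H_1(U) = 0 and the kernel of H_0(K) -> H_0(U),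
    which the last hypothesis makes zero. *)
Lemma acyc1_quot K U V (f : FImor K U) (g : FImor U V) : acyc1 U -> short_exact f g ->
  (forall n (x : fobj K n), lowdeg (mor f x) -> lowdeg x) -> acyc1 V.
Proof.
move=> aU se pure; have [P [p [ps Pp _ _]]] := cover_ex U.
have [N [j jp]] := short_exact_ker ps.
have [L [l [c [r [lse cse lc rl]]]]] := preimage_ex se jp.
apply: (acyc1_cover Pp lse) => n x lx.
have [_ cr rs] := cse.
have [|x' [lx' xE]] := lowdeg_lift (y := mor r x) rs.
  by apply: pure; rewrite rl; apply: lowdeg_mor.
have /cr[t tE] : mor r (x - x') = 0 by rewrite morB xE subrr.
rewrite -[x](subrK x') -tE; apply: lowdegD => //; apply: lowdeg_mor.
by apply: (aU _ _ _ _ jp); rewrite -lc tE morB; apply: lowdegB => //; apply: lowdeg_mor.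
Qed.

Inductive lowgen V m n : fobj V n -> Prop :=
  | lowgen0 : lowgen m 0
  | lowgen_im j (lt_jm : (j < m)%N) (h : FIhom G j n) (y : fobj V j) : lowgen m (fmap V h y)
  | lowgen_lin a x y : lowgen m x -> lowgen m y -> lowgen m (a *: x + y).

Lemma lowgen_subFI V m : subFI (fun n => @lowgen V m n).
Proof.
split=> [n|n n' h x].
  by split=> [|a x y]; [apply: lowgen0 | apply: lowgen_lin].
elim=> [|j lt_jm h' y|a u v _ Hu _ Hv].
- by rewrite fmap0; apply: lowgen0.
- by rewrite -fmap_comp; apply: lowgen_im.
- by rewrite fmap_lin; apply: lowgen_lin.
Qed.

(* X is the submodule of V generated in degrees < m. *)
Lemma trunc_ex V m : exists X Q (i : FImor X V) (q : FImor V Q),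
  [/\ short_exact i q, gen_lt m X, forall n, (n < m)%N -> forall x : fobj Q n, x = 0 &
      forall n (x : fobj X n), lowdeg (mor i x) -> lowdeg x].
Proof.
have [X [i [iI iS]]] := sub_FI (lowgen_subFI V m).
have [Q [q se]] := short_exact_coker iI; have [_ ex qs] := se.
have low n (lt_nm : (n < m)%N) (y : fobj V n) : exists x, mor i x = y.
  by apply/iS; rewrite -[y]fmap_id; apply: lowgen_im.
have Xm : gen_lt m X.
  move=> n mn x; suff [x' lx' /iI <- //] : exists2 x', lowdeg x' & mor i x' = mor i x.
  have : lowgen m (mor i x) by apply/iS; exists x.
  elim=> [|j lt_jm h y|a u v _ [x1 l1 <-] _ [x2 l2 <-]].
  - by exists 0; rewrite ?mor0 //; apply: lowdeg0.
  - have [z <-] := low j lt_jm y; exists (fmap X h z); last by rewrite mor_nat.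
    by apply: lowdeg_im; apply: leq_trans mn.
  - by exists (a *: x1 + x2); [apply/lowdegD/l2/lowdegZ | rewrite mor_lin].
exists X, Q, i, q; split=> // [n lt_nm x|n x lx].
  by have [y <-] := qs n x; apply/ex; apply: low.
(* From degree m on, all of [X] is low by generation; below m, [X] and [V] coincide. *)
have [mn|lt_nm] := leqP m n; first exact: Xm.
suff [x' lx' /iI <- //] : exists2 x', lowdeg x' & mor i x' = mor i x.
elim: lx => [|j lt_jn h y|u v _ [x1 l1 <-] _ [x2 l2 <-]|a u _ [x1 l1 <-]].
- by exists 0; rewrite ?mor0 //; apply: lowdeg0.
- have [z <-] := low j (ltn_trans lt_jn lt_nm) y; exists (fmap X h z); last by rewrite mor_nat.
  exact: lowdeg_im.
- by exists (x1 + x2); [apply: lowdegD | rewrite morD].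
- by exists (a *: x1); [apply: lowdegZ | rewrite morZ].
Qed.

Lemma gen_lt0 V : gen_lt 0 V -> is_zero V.
Proof.
move=> V0; elim/ltn_ind => n IH x; elim: (V0 n isT x) => [|m lt h y|u v _ -> _ ->|a u _ ->] //.
- by rewrite (IH m lt y) fmap0.
- by rewrite addr0.
- by rewrite scaler0.
Qed.

(** This is Nakayama's lemma: surjectivity modulo low elements suffices, by strong induction on the
    degree. *)
Lemma surj_of_gen P V (p : FImor P V) :
  (forall n (y : fobj V n), lowdeg y \/ exists x, mor p x = y) -> mor_surj p.
Proof.
move=> pg; elim/ltn_ind => n IH y; case: (pg n y) => //.
elim=> [|m lt_mn h u|u v _ [x <-] _ [x' <-]|a u _ [x <-]].
- by exists 0; rewrite mor0.
- by have [x <-] := IH m lt_mn u; exists (fmap P h x); rewrite mor_nat.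
- by exists (x + x'); rewrite morD.
- by exists (a *: x); rewrite morZ.
Qed.

(** The module [Q] is M(Q_m). Take the free module on the elements of Q_m, with kernel [K] over [Q]:
    vanishing of H_1 makes K generated in degree m, where its relations are just those of the
    k[G_m]-module Q_m. *)
Lemma acyc1_one_degree Q m : (forall n, (n < m)%N -> forall x : fobj Q n, x = 0) ->
  gen_lt m.+1 Q -> acyc1 Q -> rel_projective Q.
Proof.
move=> Q0 Qm aQ.
have [P [e Pf]] := @kfree_ex k G (fobj Q m) (fun _ => m).
have [p pE] := kfree_map Pf (fun x => x).
have ps : mor_surj p.
  apply: surj_of_gen => n y; have [lt_mn|] := ltnP m n; first by left; apply: Qm.
  rewrite leq_eqVlt => /predU1P[E|lt_nm]; right.
    by move: y; rewrite E => y; exists (e y); apply: pE.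
  by exists 0; rewrite mor0 (Q0 _ lt_nm y).
pose S n (x : fobj Q n) := n = m \/ x = 0.
have Se x : S m x by left.
apply: (@rel_projective_sub _ _ Q S).
- move=> n; split=> [|a x y [nm|->] [nm'|->]]; rewrite /S; auto.
  by right; rewrite scaler0 addr0.
- by move=> n s x [nm|->]; [left | right; rewrite fmap0].
- move=> M Z psi psil psib.
  have psi0 n h : psi n 0 h = 0.
    have S0 : S n 0 by right.
    have := psil n h 1 0 0 S0 S0.
    by rewrite !scale1r addr0 -{1}[psi n 0 h]addr0 => /addrI <-.
  have [F [Fl FE _]] := Pf M Z (fun x h => psi m x h).
  have [K [i se]] := short_exact_ker ps.
  have Fm (z : fobj P m) (h : FIhom G m M) : F (fmap P h z) = psi m (mor p z) h.
    have l1 : klinear (fun z => F (fmap P h z)) by exact: (klin_comp (fmap_lin P h) Fl).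
    have l2 : klinear (fun z => psi m (mor p z) h).
      by move=> a x y; rewrite mor_lin psil.
    move: z; apply: (kfree_ext Pf l1 l2) => x s.
    by rewrite -fmap_comp FE mor_nat pE psib.
  (* Below m the free module is zero; above m, [x] is low because H_1(Q) = 0, and induction applies;
     in degree m, [Fm] computes the value from the image of [x] in [Q], which is 0. *)
  have FK n (x : fobj K n) (h : FIhom G n M) : F (fmap P h (mor i x)) = 0.
    elim/ltn_ind: n x h => n IH x h; case: (ltngtP n m) => [lt_nm|lt_mn|E].
    - suff z0 (z : fobj P n) : z = 0 by rewrite (z0 (mor i x)) fmap0 (klin0 Fl).
      have l1 : klinear (fun z : fobj P n => z) by [].
      move: z; apply: (kfree_ext Pf l1 (@klin_const0 _ _ _)) => w h'.
      by have := FIhom_leq h'; rewrite leqNgt lt_nm.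
    - have : lowdeg x.
        by apply: (aQ _ _ _ _ se); apply: (kfree_gen_lt Pf (m := m.+1)).
      elim=> [|j lt_jn h' y|u v _ Hu _ Hv|a u _ Hu].
      + by rewrite mor0 fmap0 (klin0 Fl).
      + by rewrite mor_nat -fmap_comp IH.
      + by rewrite morD fmapD (klinD Fl) Hu Hv addr0.
      + by rewrite morZ fmapZ (klinZ Fl) Hu scaler0.
    - move: x h {IH}; rewrite E => x h; rewrite Fm (short_exact0 _ se); exact: psi0.
  have [|f fl fE] := factor_epi_lin (@mor_lin _ _ _ _ p M) (@ps M) Fl.
    case: se => _ ex _ z /ex[x <-]; rewrite -[mor i x](fmap_id (f := P)); exact: FK.
  exists f => // n x h [E|->]; last by rewrite fmap0 (klin0 fl) psi0.
  by move: x h; rewrite E => x h; rewrite -FE -fE mor_nat pE.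
- move=> M Z f fl f0 y; have [z <-] := ps M y.
  have l1 : klinear (fun z : fobj P M => f (mor p z)) by exact: (klin_comp (@mor_lin _ _ _ _ p M) fl).
  apply: (kfree_ext Pf l1 (@klin_const0 _ _ _)) => x h.
  by rewrite mor_nat pE f0 //; left.
Qed.

(** An inductive form of [sharp_filtered] without indexed families, so that proofs go by induction
    on the filtration. *)
Inductive sharpI : FImod -> Prop :=
  | sharpI0 V : is_zero V -> sharpI V
  | sharpI_ext X V Q (i : FImor X V) (q : FImor V Q) :
      sharpI X -> rel_projective Q -> short_exact i q -> sharpI V.

Lemma sharpI_T V : sharpI V -> T V.
Proof.
elim=> [{}V V0|X {}V Q i q _ TX rQ se]; first exact: T_zero.
exact: T_ext se TX (rel_projective_T rQ).
Qed.

Lemma acyc1_sharpI V : fg V -> acyc1 V -> sharpI V.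
Proof.
move=> [m]; elim: m V => [|m IH] V Vm aV; first by apply/sharpI0/gen_lt0.
have [X [Q [i [q [se Xm Q0 pure]]]]] := trunc_ex V m.
have aQ : acyc1 Q := acyc1_quot aV se pure.
have rQ : rel_projective Q.
  apply: acyc1_one_degree Q0 _ aQ => n mn x; case: se => _ _ /(_ n x)[y <-].
  exact/lowdeg_mor/Vm.
apply: (sharpI_ext (IH _ Xm _) rQ se).
(* It remains to see that H_1(X) = 0. The preimage [L] of [X] in the cover is the kernel of P -> Q,
   so it has [T]; and H_0(K) -> H_0(L) is injective because its composite to H_0(P) is, by H_1(V) =
   0. *)
have [P [p [ps Pp TP _]]] := cover_ex V.
have [K [j jp]] := short_exact_ker ps.
have [L [l [c [r [lse cse lc rl]]]]] := preimage_ex se jp.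
have TL : T L := T_ker lse TP (rel_projective_T rQ).
apply: (acyc1_quot (T_acyc1 TL) cse) => n x lx.
by apply: (aV _ _ _ _ jp); rewrite -lc; apply: lowdeg_mor.
Qed.

End AcyclicFiltration.

(** * Finite presentation and coherence *)

Section Coherence.
Variables (k : comPzRingType) (G : groupType).
Notation FImod := (FImod k G).
Implicit Types A B C I K L M N P Q U V W X Z : FImod.

(* For V generated in finite degree, fp1 V says that V is presented in finite degree. *)
Definition fp1 V := forall A B (f : FImor A B) (g : FImor B V),
  short_exact f g -> fg B -> fg A.

Lemma fg_quot A B (p : FImor A B) : mor_surj p -> fg A -> fg B.
Proof.
by move=> ps [m Am]; exists m => n mn y; have [x <-] := ps n y; apply/lowdeg_mor/Am.
Qed.

Lemma fg_ext A B C (f : FImor A B) (g : FImor B C) :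
  short_exact f g -> fg A -> fg C -> fg B.
Proof.
move=> [_ ex gs] [m Am] [m' Cm']; exists (maxn m m') => n; rewrite geq_max => /andP[mn m'n] b.
have [b' [lb' bE]] := lowdeg_lift gs (Cm' n m'n (mor g b)).
have /ex[a aE] : mor g (b - b') = 0 by rewrite morB bE subrr.
by rewrite -[b](subrK b') -aE; apply: lowdegD => //; apply/lowdeg_mor/Am.
Qed.

Lemma gen_lt_D m V : gen_lt m.+1 V -> gen_lt m (D V).
Proof. by move=> Vm n mn x; have [y <-] := dp_surj x; apply/lowdeg_dp/Vm. Qed.

Lemma fg_D V : fg V -> fg (D V).
Proof. by case=> m Vm; exists m; apply: gen_lt_D => n mn; apply/Vm/ltnW. Qed.

Lemma D_fg V : fg (D V) -> fg V.
Proof. by case=> m Vm; exists m.+1 => -[//|n] mn x; apply/dp_lowdeg/Vm. Qed.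

Lemma fp1_cover V K P (i : FImor K P) (p : FImor P V) :
  projective P -> short_exact i p -> fg K -> fp1 V.
Proof.
move=> Pp se [m Km] A B f g se' [m' Bm']; have [c cP] := compare Pp se se'.
exists (maxn m m') => n; rewrite geq_max => /andP[mn m'n] a.
have [x [a' [_ la' ->]]] := cP n a (Bm' n m'n _).
by apply: lowdegD => //; apply/lowdeg_mor/Km.
Qed.

Lemma fp1_ext A B C (f : FImor A B) (g : FImor B C) :
  short_exact f g -> fp1 A -> fp1 C -> fp1 B.
Proof.
move=> se fA fC N U j p jp Ufg; have [L [l [c [r [lse cse _ _]]]]] := preimage_ex se jp.
exact: fA cse (fC _ _ _ _ lse Ufg).
Qed.

(** Elements of B_(n+1) that are low are sums of images from degree n. As soon as n >= a, B_n equals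
    A_n, so these already come from [A]; the successor in the bound accounts for this step down. *)
Lemma fp1_finite_degree N a :
  (forall n, (a <= n)%N -> forall x : fobj N n, x = 0) -> fp1 N.
Proof.
move=> N0 A B f g [fI ex _] [m Bm]; exists (maxn a m).+1 => -[//|n].
rewrite ltnS geq_max => /andP[an mn] x.
suff [x' lx' /fI <- //] : exists2 x', lowdeg x' & mor f x' = mor f x.
elim: (Bm n.+1 (leqW mn) (mor f x)) => [|j lt_jn h y|u v _ [x1 l1 <-] _ [x2 l2 <-]|s u _ [x1 l1 <-]].
- by exists 0; rewrite ?mor0 //; apply: lowdeg0.
- have [h1 [h2 ->]] := FIhom_factor h lt_jn.
  have /ex[z zE] : mor g (fmap B h2 y) = 0 by apply: N0.
  by exists (fmap A h1 z); [apply: lowdeg_im | rewrite mor_nat zE fmap_comp].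
- by exists (x1 + x2); [apply: lowdegD | rewrite morD].
- by exists (s *: x1); [apply: lowdegZ | rewrite morZ].
Qed.

(** Every map to a larger object begins with [iota] and hence acts by zero, so low elements
    vanish. *)
Lemma iota0_finite_degree N : (forall n (x : fobj N n), fmap N (iota n) x = 0) -> fg N ->
  exists a, forall n, (a <= n)%N -> forall x : fobj N n, x = 0.
Proof.
move=> i0 [a Na]; exists a => n an x.
elim: (Na n an x) => [//|m lt_mn h y|u v _ -> _ ->|s u _ ->]; rewrite ?addr0 ?scaler0 //.
by have [h' ->] := FIhom_extend h lt_mn; rewrite fmap_comp i0 fmap0.
Qed.

Lemma coherence m P K (i : FImor K P) :
  mor_inj i -> T P -> gen_lt m P -> fg K -> fp1 K.
Proof.
elim: m P K i => [|m IH] P K i iI TP Pm Kfg.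
  by apply: (@fp1_finite_degree _ 0%N) => n _ x; apply: iI; rewrite mor0 (gen_lt0 Pm (mor i x)).
have [I [j [q [jI qs jq]]]] := image_ex (Dm i).
have DKfg := fg_D Kfg.
have fpI : fp1 I := IH _ _ j jI (T_D TP) (gen_lt_D Pm) (fg_quot qs DKfg).
have [N [t tse]] := short_exact_ker qs; have [tI tq _] := tse.
(* An element [dp y] of [N] has i(y) in the image of [iota], so [iota] and [ext (iota n)] agree on
   [y] by [ext_iota]. Hence [iota] kills [dp y]. *)
have [|a Na] := iota0_finite_degree _ (fpI _ _ _ _ tse DKfg).
  move=> n x; apply: tI; rewrite mor_nat mor0; have [y yE] := dp_surj (mor t x).
  have : mor (Dm i) (mor t x) = 0 by rewrite -jq (short_exact0 _ tse) mor0.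
  rewrite -yE DmE => /dp_eq0[b bE]; rewrite dp_fmap; apply/dp_eq0; exists y.
  by apply: iI; rewrite !mor_nat -bE -!fmap_comp ext_iota.
have fpDK : fp1 (D K) := fp1_ext tse (fp1_finite_degree Na) fpI.
move=> A B f g se Bfg; apply: D_fg; apply: fpDK (fg_D Bfg).
exact: D_exact se (tf_sub iI (T_tf TP)).
Qed.

(** Since H_1(M) = 0, the kernel of the cover has no generators beyond the generation degree of the
    cover. *)
Lemma T_fp1 M : T M -> fg M -> fp1 M.
Proof.
move=> TM [m Mm]; have [P [p [ps Pp _ Pm]]] := cover_ex M.
have [N [j jp]] := short_exact_ker ps; apply: (fp1_cover Pp jp).
by exists m => n mn x; apply: (T_acyc1 TM jp); apply: Pm Mm _ mn _.
Qed.

(** The given presentation starts from a relatively projective [M], not necessarily projective. Over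
    a cover of [M], the kernel becomes an extension of [K] by the kernel of the cover, which [T_fp1]
    bounds. *)
Lemma presented_fp1 V : presented_finite V -> fp1 V.
Proof.
move=> [/gen_finite_fg Vfg [r [K [M [i [p [se rM /gen_in_deg_lt Kr]]]]]]].
have Kfg : fg K by exists r.+1.
have Mfg := fg_ext se Kfg Vfg; have TM := rel_projective_T rM.
have [P [q [qs Pp _ Pm]]] := cover_ex M; have [N [j jq]] := short_exact_ker qs.
have [L [l [c [s [lse cse _ _]]]]] := preimage_ex se jq.
apply: (fp1_cover Pp lse); apply: (fg_ext cse) => //.
by apply: (T_fp1 TM Mfg jq); case: Mfg => m Mm; exists m; apply: Pm.
Qed.

End Coherence.

(** * Canonical resolutions, syzygies and homology *)

Section Resolution.
Variables (k : comPzRingType) (G : groupType).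
Notation FImod := (FImod k G).
Implicit Types A B C I K L P Q V X Z : FImod.

Lemma syzygy_ex V : exists t : {PK : FImod * FImod & FImor PK.2 PK.1 * FImor PK.1 V}%type,
  [/\ short_exact (tagged t).1 (tagged t).2, projective (tag t).1,
      T (tag t).1 & forall m, gen_lt m V -> gen_lt m (tag t).1].
Proof.
have [P [p [ps Pp TP Pm]]] := cover_ex V; have [K [i se]] := short_exact_ker ps.
by exists (existT (fun PK : FImod * FImod => FImor PK.2 PK.1 * FImor PK.1 V)%type (P, K) (i, p)).
Qed.

Definition cover V : FImod := (tag (sval (cid (syzygy_ex V)))).1.
Definition syzygy V : FImod := (tag (sval (cid (syzygy_ex V)))).2.
Definition syzygy_map V : FImor (syzygy V) (cover V) := (tagged (sval (cid (syzygy_ex V)))).1.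
Definition cover_map V : FImor (cover V) V := (tagged (sval (cid (syzygy_ex V)))).2.

Lemma syzygyP V : [/\ short_exact (syzygy_map V) (cover_map V), projective (cover V),
  T (cover V) & forall m, gen_lt m V -> gen_lt m (cover V)].
Proof. exact: svalP (cid (syzygy_ex V)). Qed.

Definition res_diff V j : FImor (cover (iter j.+1 syzygy V)) (cover (iter j syzygy V)) :=
  compM (syzygy_map (iter j syzygy V)) (cover_map (iter j.+1 syzygy V)).

Lemma resolution V : proj_resolution (res_diff V) (cover_map V).
Proof.
split=> [j||n y|j n y].
- by case: (syzygyP (iter j syzygy V)).
- by case: (syzygyP V) => -[].
- have [[_ ex _] _ _ _] := syzygyP V; have [[_ _ s] _ _ _] := syzygyP (syzygy V).
  split=> [/ex[z <-]|[x <-]]; last by apply/ex; eexists.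
  by have [x <-] := s _ z; exists x.
set Z := iter j syzygy V.
have [[iI _ _] _ _ _] := syzygyP Z.
have [[_ ex _] _ _ _] := syzygyP (syzygy Z).
have [[_ _ s] _ _ _] := syzygyP (syzygy (syzygy Z)).
split=> [/(mor_inj_eq0 iI)/ex[z <-]|[x <-]]; first by have [x <-] := s _ z; exists x.
rewrite -[LHS]/(mor (syzygy_map Z) (mor (cover_map (syzygy Z)) _)).
by have /ex -> : exists z, mor (syzygy_map (syzygy Z)) z = mor (res_diff V j.+1) x;
  [eexists | rewrite mor0].
Qed.

(** Dimension shifting along the canonical resolution: a lift of [x] is a cycle modulo low elements,
    hence a boundary plus a low element, and the boundary dies in the syzygy. *)
Lemma H_vanishes_syzygy V i : H_vanishes V i.+1 -> acyc1 (iter i syzygy V).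
Proof.
move=> /(_ _ _ _ (resolution V)) H.
set Z := iter i syzygy V; have [se Pp _ _] := syzygyP Z.
apply: (acyc1_cover Pp se) => n x lx.
have [[_ ex s] _ _ _] := syzygyP (syzygy Z); have [u uE] := s n x.
have [|y [z [lz zE]]] := H n u; first by rewrite /= uE.
rewrite -uE zE morD; have -> : mor (cover_map (syzygy Z)) (mor (res_diff V i.+1) y) = 0.
  by apply/ex; eexists.
by rewrite add0r; apply: lowdeg_mor.
Qed.

Lemma T_homology_acyclic V : T V -> homology_acyclic V.
Proof.
move=> TV [//|i] _ P d eps [Pp es e0 ej] n x lx.
(* [Z] is the i-th syzygy of the given resolution, [V] itself for i = 0. It has [T] as an iterated
   kernel of surjections between modules with [T]. *)
have [Z [q [TZ qs qex]]] : exists Z (q : FImor (P i) Z), [/\ T Z, mor_surj q & exact_at (d i) q].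
  elim: i {n x lx} => [|i [Z [q [TZ qs qex]]]]; first by exists V, eps.
  have [K [j se]] := short_exact_ker qs; have [jI jex _] := se.
  have [|r rE] := factor_mono (u := d i) jI.
    by move=> n x; apply/jex/qex; exists x.
  exists K, r; split=> [|n y|n y].
  - exact: T_ker se (projective_T (Pp i)) TZ.
  - have /qex[x xE] : mor q (mor j y) = 0 by apply/jex; exists y.
    by exists x; apply: jI; rewrite rE.
  - by rewrite -(ej i n y) -rE; split=> [->|/(mor_inj_eq0 jI)//]; rewrite mor0.
have [K [j se]] := short_exact_ker qs; have [jI jex _] := se.
have [|r rE] := factor_mono (u := d i) jI.
  by move=> m y; apply/jex/qex; exists y.
have rs : mor_surj r.
  move=> m y; have /qex[z zE] : mor q (mor j y) = 0 by apply/jex; exists y.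
  by exists z; apply: jI; rewrite rE.
have lr : lowdeg (mor r x) by apply: (T_acyc1 TZ se); rewrite rE.
have [z [lz zE]] := lowdeg_lift rs lr.
have /ej[y yE] : mor (d i) (x - z) = 0 by rewrite -rE morB zE subrr mor0.
by exists y, z; rewrite yE subrK.
Qed.

Lemma syzygy_T V i : T (iter i syzygy V) -> T V.
Proof.
elim: i => [//|i IH] TZ; apply: IH; have [se _ TP _] := syzygyP (iter i syzygy V).
exact: T_coker se TZ TP.
Qed.

(** The induction carries [fp1] along: it bounds the generators of the next syzygy, and [coherence]
    inside the cover restores it there. *)
Lemma syzygy_fg V i : fg V -> fp1 V -> fg (iter i syzygy V).
Proof.
move=> Vfg Vfp; suff: fg (iter i syzygy V) /\ fp1 (iter i syzygy V) by case.
elim: i => [//|i [[m Zm] Zfp]]; have [se _ TP Pm] := syzygyP (iter i syzygy V).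
have Kfg : fg (iter i.+1 syzygy V) by apply: (Zfp _ _ _ _ se); exists m; apply: Pm.
by split=> //; case: se => iI _ _; apply: coherence iI TP (Pm m Zm) Kfg.
Qed.

Lemma T_iso A B (f : FImor A B) : mor_inj f -> mor_surj f -> T A -> T B.
Proof.
move=> fI fs TA; have [K [i se]] := short_exact_ker fs.
apply: (T_coker se) => //; apply: T_zero => n x; have [iI _ _] := se.
by apply: (mor_inj_eq0 iI); apply: (mor_inj_eq0 fI); apply: short_exact0 se.
Qed.

Lemma acyclic_sharpI V : fg V -> H_vanishes V 1 -> sharpI V.
Proof. by move=> Vfg /(@H_vanishes_syzygy V 0); apply: acyc1_sharpI. Qed.

Lemma acyclic_fin_resolution_T V : acyclic_fin_resolution V -> T V.
Proof.
move=> [s [P [d [eps [Pa es e0 es0 ej]]]]].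
have TP j : (j <= s)%N -> T (P j).
  by move=> /Pa[aP /gen_finite_fg fgP]; apply/sharpI_T/acyclic_sharpI => //; apply: aP.
case: s => [|s] in Pa e0 es0 ej TP *; first exact: T_iso (e0 _) es (TP 0%N _).
have [ex0 dI] := es0 isT.
(* [I] is the image of [d j]. The recursion starts at the injective left end [d s]; further right,
   the image of [d j] is the quotient of [P j.+1] by that of [d j.+1], so [T_coker] applies. *)
have im t j : (j + t)%N = s -> exists I (i : FImor I (P j)),
    [/\ mor_inj i, T I & forall n (y : fobj (P j) n),
      (exists x, mor i x = y) <-> exists x, mor (d j) x = y].
  elim: t j => [|t IH] j js; have [I [i [q [iI qs qE]]]] := image_ex (d j).
    exists I, i; rewrite addn0 in js; split=> //.
      apply: T_iso qs (TP j.+1 _); last by rewrite js.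
      by move=> n x y exy; move: dI; rewrite -js => /(_ n); apply; rewrite -!qE exy.
    move=> n y; split=> -[x <-]; last by exists (mor q x).
    by have [z <-] := qs n x; exists z.
  have [|I' [i' [iI' TI' iE']]] := IH j.+1; first by rewrite addSnnS.
  exists I, i; split=> //.
    have lt_js : (j.+1 < s.+1)%N by rewrite ltnS -js -addSnnS leq_addr.
    apply: (@T_coker _ _ _ _ _ i' q) => //; last by apply: TP; apply: ltnW.
    split=> // n y; rewrite iE' -(ej j lt_js n y) -qE.
    by split=> [->|/(mor_inj_eq0 iI)//]; rewrite mor0.
  move=> n y; split=> -[x <-]; last by exists (mor q x).
  by have [z <-] := qs n x; exists z.
have [I [i [iI TI iE]]] := im s 0%N (add0n s).
apply: (@T_coker _ _ _ _ _ i eps) => //; last exact: TP.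
by split=> // n y; rewrite iE; apply: ex0.
Qed.

(** * Filtrations by submodules and towers of quotients *)

Inductive surjI : FImod -> Prop :=
  | surjI0 V : is_zero V -> surjI V
  | surjI_ext K V X (i : FImor K V) (q : FImor V X) :
      surjI X -> rel_projective K -> short_exact i q -> surjI V.

Lemma surjI_T V : surjI V -> T V.
Proof.
elim=> [{}V V0|K {}V X i q _ TX rK se]; first exact: T_zero.
exact: T_ext se (rel_projective_T rK) TX.
Qed.

(** A tower for [A] removes submodules from the bottom, so its first kernel [K] is also divided out
    of [Y], and Y/K is an extension of [R] by A/K. When [A] is exhausted, [Y] is isomorphic to
    [R]. *)
Lemma surjI_sub A Y R (f : FImor A Y) (g : FImor Y R) :
  surjI A -> rel_projective R -> short_exact f g -> surjI Y.
Proof.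
move=> sA rR; elim: sA Y f g => {A} [A A0|K A X i q _ IH rK [iI iq qs]] Y f g [fI fg gs].
  have gI : mor_inj g.
    by apply: mor_inj0 => n y /fg[x <-]; rewrite (A0 _ x) mor0.
  have [|v vE] := factor_mono (u := idM R) gI; first by move=> n x; apply: gs.
  apply: (@surjI_ext R Y A v (zeroM Y A)) => //; first exact: surjI0.
  split=> [n x y exy|n y|n x]; first by rewrite -[x]vE exy vE.
    by split=> // _; exists (mor g y); apply: gI; rewrite vE.
  by exists 0; rewrite (A0 _ x).
have fiI : mor_inj (compM f i) by move=> n x y /fI/iI.
have [Q [p se]] := short_exact_coker fiI; have [_ pe ps] := se.
have [|v vE] := factor_epi (u := compM p f) qs.
  by move=> n a /iq[x <-]; apply/pe; exists x.
have [|w wE] := factor_epi (u := g) ps.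
  by move=> n y /pe[x <-]; apply/fg; eexists.
apply: (surjI_ext _ rK se); apply: (IH Q v w); split.
- apply: mor_inj0 => n x; have [a <-] := qs n x; rewrite vE => /pe[z /fI zE].
  by apply/iq; exists z.
- move=> n x; have [y <-] := ps n x; rewrite wE; split=> [/fg[a <-]|[z]].
    by exists (mor q a); rewrite vE.
  have [a <-] := qs n z; rewrite vE -wE => <-; rewrite wE.
  by apply/fg; exists a.
- by move=> n z; have [y <-] := gs n z; exists (mor p y); rewrite wE.
Qed.

Lemma sharpI_surjI V : sharpI V -> surjI V.
Proof.
by elim=> [{}V V0|X {}V Q i q _ sX rQ se]; [apply: surjI0 | apply: surjI_sub sX rQ se].
Qed.

Lemma sharp_filteredP V : sharp_filtered V <-> sharpI V.
Proof.
split=> [[n [F [R [i [q [F0 <- Fs]]]]]]|].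
  suff: forall j, (j <= n)%N -> sharpI (F j) by apply.
  elim=> [_|j IH lt_jn]; first exact: sharpI0.
  by have [rR se] := Fs j lt_jn; apply: sharpI_ext (IH (ltnW lt_jn)) rR se.
pose step X Y := exists R (i : FImor X Y) (q : FImor Y R), rel_projective R /\ short_exact i q.
suff: sharpI V -> exists n (F : nat -> FImod),
    [/\ is_zero (F 0%N), F n = V & forall j, (j < n)%N -> step (F j) (F j.+1)].
  move=> H /H[n [F [F0 Fn Fs]]].
  (* The families in [sharp_filtered] are total in j, so zero maps fill the indices from n on. *)
  have ex j : exists t : {R : FImod & FImor (F j) (F j.+1) * FImor (F j.+1) R}%type,
      (j < n)%N -> rel_projective (tag t) /\ short_exact (tagged t).1 (tagged t).2.
    have [lt_jn|_] := ltnP j n.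
      have [R [i [q Rq]]] := Fs j lt_jn.
      by exists (existT (fun R => FImor (F j) (F j.+1) * FImor (F j.+1) R)%type R (i, q)).
    by exists (existT (fun R => FImor (F j) (F j.+1) * FImor (F j.+1) R)%type (F j)
      (zeroM _ _, zeroM _ _)).
  exists n, F, (fun j => tag (sval (cid (ex j)))), (fun j => (tagged (sval (cid (ex j)))).1),
    (fun j => (tagged (sval (cid (ex j)))).2); split=> // j.
  exact: svalP (cid (ex j)).
elim=> [{}V V0|X {}V Q i q _ [n [F [F0 Fn Fs]]] rQ se].
  by exists 0%N, (fun _ => V).
exists n.+1, (fun j => if (j <= n)%N then F j else V); rewrite ltnn; split=> // j lt_jn1.
have [->|lt_jn] : j = n \/ (j < n)%N by apply/predU1P; rewrite -leq_eqVlt.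
  by rewrite leqnn ltnn Fn; exists Q, i, q.
by rewrite (ltnW lt_jn) lt_jn; apply: Fs.
Qed.

Lemma surj_filteredP V : surj_filtered V <-> surjI V.
Proof.
split=> [[n [Q [K [q [i [<- Q0 Qs]]]]]]|].
  suff: forall j, (j <= n)%N -> surjI (Q j) by apply.
  elim=> [_|j IH lt_jn]; first exact: surjI0.
  by have [rK se] := Qs j lt_jn; apply: surjI_ext (IH (ltnW lt_jn)) rK se.
pose step Y X := exists K (q : FImor Y X) (i : FImor K Y), rel_projective K /\ short_exact i q.
suff: surjI V -> exists n (Q : nat -> FImod),
    [/\ Q n = V, is_zero (Q 0%N) & forall j, (j < n)%N -> step (Q j.+1) (Q j)].
  move=> H /H[n [Q [Qn Q0 Qs]]].
  have ex j : exists t : {K : FImod & FImor (Q j.+1) (Q j) * FImor K (Q j.+1)}%type,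
      (j < n)%N -> rel_projective (tag t) /\ short_exact (tagged t).2 (tagged t).1.
    have [lt_jn|_] := ltnP j n.
      have [K [q [i Kq]]] := Qs j lt_jn.
      by exists (existT (fun K => FImor (Q j.+1) (Q j) * FImor K (Q j.+1))%type K (q, i)).
    by exists (existT (fun K => FImor (Q j.+1) (Q j) * FImor K (Q j.+1))%type (Q j)
      (zeroM _ _, zeroM _ _)).
  exists n, Q, (fun j => tag (sval (cid (ex j)))), (fun j => (tagged (sval (cid (ex j)))).1),
    (fun j => (tagged (sval (cid (ex j)))).2); split=> // j.
  exact: svalP (cid (ex j)).
elim=> [{}V V0|K {}V X i q _ [n [Q [Qn Q0 Qs]]] rK se].
  by exists 0%N, (fun _ => V).
exists n.+1, (fun j => if (j <= n)%N then Q j else V); rewrite ltnn; split=> // j lt_jn1.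
have [->|lt_jn] : j = n \/ (j < n)%N by apply/predU1P; rewrite -leq_eqVlt.
  by rewrite leqnn ltnn Qn; exists K, q, i.
by rewrite (ltnW lt_jn) lt_jn; apply: Qs.
Qed.

End Resolution.

Theorem theoremB (k : comPzRingType) (G : groupType) (V : FImod k G) :
  gen_finite V ->
  [/\ sharp_filtered V <-> surj_filtered V,
      sharp_filtered V <-> homology_acyclic V,
      sharp_filtered V <-> H_vanishes V 1,
      sharp_filtered V <-> acyclic_fin_resolution V &
      presented_finite V ->
        (sharp_filtered V <-> exists i, (0 < i)%N /\ H_vanishes V i)].
Proof.
move=> Vgen; have Vfg := gen_finite_fg Vgen.
have TS : T V -> sharpI V by move=> TV; apply: acyc1_sharpI (T_acyc1 TV).
have SH : sharpI V -> homology_acyclic V by move=> /sharpI_T; apply: T_homology_acyclic.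
have -> : sharp_filtered V = sharpI V by apply/propext/sharp_filteredP.
have -> : surj_filtered V = surjI V by apply/propext/surj_filteredP.
split.
- by split=> [|/surjI_T/TS//]; apply: sharpI_surjI.
- by split=> [/SH//|/(_ 1%N isT)]; apply: acyclic_sharpI.
- by split=> [/SH/(_ 1%N isT)//|]; apply: acyclic_sharpI.
- split=> [/SH aV|/acyclic_fin_resolution_T/TS//].
  (* An acyclic [V] is its own resolution, of length 0. *)
  exists 0%N, (fun _ => V), (fun _ => zeroM V V), (idM V); split=> // [n x|_ n x y //]; exists x; reflexivity.
- move=> Vp; split=> [/SH aV|[[|i] [i0 Hi]]//]; first by exists 1%N; split=> //; apply: aV.
  (* The index is now i + 1, and its vanishing says that H_1 of the i-th syzygy is 0. That syzygy is
     generated in finite degree, so it has [T], which passes back to [V]. *)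
  apply/TS/(@syzygy_T _ _ V i)/sharpI_T/acyc1_sharpI; last exact: H_vanishes_syzygy.
  exact: syzygy_fg Vfg (presented_fp1 Vp).
Qed.
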